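(* Let $f:\Sigma^*\to\Sigma^*$ be a partial recursive function. There is a constant $c$ depending only on $f$ such that for all $x\in\Sigma^*$, $$\mathbf{I}(f(x);\mathcal{H}) < \mathbf{I}(x;\mathcal{H})+c.$$
   Context: $\Sigma=\{0,1\}$, $\Sigma^*$ the finite binary strings, $\perp$ the empty string. $\mathbf{K}(x\mid z)$ is prefix Kolmogorov complexity relative to auxiliary input $z$ with respect to a fixed universal prefix-free machine $U_z$; $\mathbf{K}(x)=\mathbf{K}(x\mid\perp)$. $\mathcal{H}$ is the halting sequence (characteristic sequence of the domain of $U$), and $\mathbf{I}(x;\mathcal{H})=\mathbf{K}(x)-\mathbf{K}(x\mid\mathcal{H})$. A partial recursive function $f$ is one computed by a Turing machine $T$, with the convention $f(x)=\perp$ if $T$ halts without output or does not halt on $x$. *)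

(* Defs.v *)
From HB Require Import structures.
From mathcomp Require Import all_boot all_order all_algebra.
From Stdlib Require Import ClassicalEpsilon.
Set Implicit Arguments. Unset Strict Implicit. Unset Printing Implicit Defensive.

(* ---------- Binary strings  Sigma^* = seq bool, coded bijectively into nat ---------- *)
Fixpoint str2nat (s : seq bool) : nat :=
  match s with
  | [::] => 0
  | b :: s' => (str2nat s').*2 + 1 + b
  end.

(* ---------- Oracles / auxiliary inputs ----------
   An oracle is a map nat -> option bool.  A finite auxiliary string z is
   represented by the oracle answering Some z_n for n < |z| and None beyond;
   an infinite sequence answers Some everywhere. *)
Definition oracle := nat -> option bool.
Definition strOracle (z : seq bool) : oracle :=
  fun n => if n < size z then Some (nth false z n) else None.
Definition emptyOracle : oracle := strOracle [::].

Definition code_ans (a : option bool) : nat :=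
  match a with None => 0 | Some false => 1 | Some true => 2 end.

Inductive prog : Type :=
| PZero : prog
| PSucc : prog
| PProj : nat -> prog
| PComp : prog -> list prog -> prog
| PPrec : prog -> prog -> prog
| PMu   : prog -> prog
| POracle : prog.

Inductive eval (O : oracle) : prog -> list nat -> nat -> Prop :=
| ev_zero v : eval O PZero v 0
| ev_succ v : eval O PSucc v (nth 0 v 0).+1
| ev_proj i v : eval O (PProj i) v (nth 0 v i)
| ev_comp f gs v w y : evals O gs v w -> eval O f w y -> eval O (PComp f gs) v y
| ev_prec0 f g v y : eval O f v y -> eval O (PPrec f g) (0 :: v) y
| ev_precS f g n v y z :
    eval O (PPrec f g) (n :: v) y -> eval O g (n :: y :: v) z ->
    eval O (PPrec f g) (n.+1 :: v) z
| ev_mu f v n :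
    eval O f (n :: v) 0 ->
    (forall m, m < n -> exists k, eval O f (m :: v) k.+1) ->
    eval O (PMu f) v n
| ev_oracle v : eval O POracle v (code_ans (O (nth 0 v 0)))
with evals (O : oracle) : list prog -> list nat -> list nat -> Prop :=
| evs_nil v : evals O nil v nil
| evs_cons g gs v y w : eval O g v y -> evals O gs v w -> evals O (g :: gs) v (y :: w).

Definition runs (O : oracle) (e : prog) (p x : seq bool) : Prop :=
  eval O e [:: str2nat p] (str2nat x).

Definition halts (O : oracle) (e : prog) (p : seq bool) : Prop :=
  exists y, eval O e [:: str2nat p] y.

(* f : Sigma^* -> Sigma^* is partial recursive: computed by some oracle-free
   machine, with the convention f x = empty string when the machine does not halt. *)
Definition partial_recursive (f : seq bool -> seq bool) : Prop :=
  exists e : prog, forall x : seq bool,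
    (forall y, runs emptyOracle e x y -> f x = y) /\
    (~ halts emptyOracle e x -> f x = [::]).

Definition prefix_free (e : prog) : Prop :=
  forall (O : oracle) (p q : seq bool),
    halts O e p -> halts O e q -> prefix p q -> p = q.

Definition universal_pf (U : prog) : Prop :=
  prefix_free U /\
  forall M : prog, prefix_free M ->
    exists q0 : seq bool, forall (O : oracle) (p x : seq bool),
      runs O U (q0 ++ p) x <-> runs O M p x.

Definition is_K (U : prog) (O : oracle) (x : seq bool) (k : nat) : Prop :=
  (exists p, size p = k /\ runs O U p x) /\
  (forall p, runs O U p x -> k <= size p).

Definition K (U : prog) (O : oracle) (x : seq bool) : nat :=
  epsilon (inhabits 0) (is_K U O x).

Definition Kcond (U : prog) (x z : seq bool) : nat := K U (strOracle z) x.
Definition Kplain (U : prog) (x : seq bool) : nat := Kcond U x [::].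

(* The halting sequence of U: bit n is 1 iff U halts on the n-th string
   (strings indexed via the bijection str2nat). *)
Definition halting_seq (U : prog) : oracle :=
  fun n => Some (if excluded_middle_informative
                      (exists y, eval emptyOracle U [:: n] y) then true else false).

Definition I_H (U : prog) (x : seq bool) : int :=
  (Kplain U x)%:Z - (K U (halting_seq U) x)%:Z.

(* Main.v *)
Require Import Defs.
From HB Require Import structures.
From mathcomp Require Import all_boot all_order all_algebra.
From mathcomp Require Import zify lra.
From Stdlib Require Import ClassicalEpsilon.
Import Order.TTheory GRing.Theory Num.Theory.
Local Open Scope ring_scope.
Set Implicit Arguments. Unset Strict Implicit. Unset Printing Implicit Defensive.

(* Let y = f(x). It suffices to show K(x|H) + K(y) <= K(x) + K(y|H) + O(1): given H and
   a shortest program of y relative to H, the program of x can be described with K(x) -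
   K(y) further bits. Indeed the programs p such that f(U(p)) = y are enumerable, and by
   the coding theorem the sum of 2^-|p| over them is at most O(2^-K(y)), so a
   Kraft-Chaitin code gives p a word of length |p| - K(y) + O(1) once K(y), which H
   computes, is known. If f is undefined at x, then f(x) is the empty string and the
   same inequality with y empty suffices. *)

(** * Functions computed by oracle programs *)

Local Open Scope nat_scope.

(** A prefix-free machine must be prefix-free under every oracle, and the same program must serve
    all of them. So computability is uniform in the oracle, and the coding machine has to behave
    well even under oracles that are not $\mathcal{H}$, where its certificates mean nothing and its
    weights may exceed 1. Codes are therefore placed so that they never overlap; the bound on the
    weights is proved for $\mathcal{H}$ only, to show that the codes exist.

    That machine also has to simulate computations with the empty oracle, since $\mathbf{K}(x)$ and
    $\mathbf{K}(y)$ refer to it, next to computations with its own oracle.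

    The value $\mathbf{K}(y)$ is obtained through the least program $r$ of $y$: the oracle tells
    which smaller programs halt, and running these to completion shows that none of them yields $y$.

    A word for $p$ alone would have to be delimited behind the program $a$ of $y$. Coding $a$, $p$
    and $r$ jointly avoids this: the factor $2^{-|a|}$ enters the weight and is summed by Kraft's
    inequality. *)

Definition computable (k : nat) (F : oracle -> seq nat -> nat) : Prop :=
  exists P, forall O v, size v = k -> eval O P v (F O v).

Lemma computable_ext k (F G : oracle -> seq nat -> nat) :
  (forall O v, size v = k -> F O v = G O v) -> computable k F -> computable k G.
Proof. by move=> eqFG [P PF]; exists P => O v sv; rewrite -eqFG //; apply: PF. Qed.

Lemma computable_var k i : computable k (fun _ v => nth 0 v i).
Proof. by exists (PProj i) => O v _; apply: ev_proj. Qed.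

Lemma computable_oracle k F :
  computable k F -> computable k (fun O v => code_ans (O (F O v))).
Proof.
move=> [P PF]; exists (PComp POracle [:: P]) => O v sv.
apply: (@ev_comp O _ _ v [:: F O v]); last exact: (ev_oracle O [:: F O v]).
by constructor; [exact: PF | constructor].
Qed.

Lemma computable_succ k F : computable k F -> computable k (fun O v => (F O v).+1).
Proof.
move=> [P PF]; exists (PComp PSucc [:: P]) => O v sv.
apply: (@ev_comp O _ _ v [:: F O v]); last exact: (ev_succ O [:: F O v]).
by constructor; [exact: PF | constructor].
Qed.

Lemma computable_const k c : computable k (fun _ _ => c).
Proof.
elim: c => [|c IHc]; first by exists PZero => O v _; apply: ev_zero.
exact: (computable_succ IHc).
Qed.

Fixpoint all_computable k (Fs : seq (oracle -> seq nat -> nat)) : Prop :=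
  if Fs is F :: Fs' then computable k F /\ all_computable k Fs' else True.

Lemma all_computable_evals k Fs : all_computable k Fs ->
  exists gs, forall O v, size v = k -> evals O gs v [seq F O v | F <- Fs].
Proof.
elim: Fs => [_|F Fs IH /= [[P PF] /IH[gs gsF]]].
  by exists [::] => O v _; constructor.
by exists (P :: gs) => O v sv; constructor; [apply: PF | apply: gsF].
Qed.

Lemma computable_comp n k G Fs : computable n G -> size Fs = n ->
  all_computable k Fs -> computable k (fun O v => G O [seq F O v | F <- Fs]).
Proof.
move=> [P PG] sFs /all_computable_evals[gs gsF]; exists (PComp P gs) => O v sv.
by apply: (ev_comp (gsF O v sv)); apply: PG; rewrite size_map.
Qed.

Lemma all_computable_vars k i n :
  all_computable k [seq (fun (_ : oracle) v => nth 0 v j) | j <- iota i n].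
Proof. by elim: n i => //= n IHn i; split; [apply: computable_var|]. Qed.

Lemma map_nth_iota_drop i k (v : seq nat) :
  size v = i + k -> [seq nth 0 v j | j <- iota i k] = drop i v.
Proof.
move=> sv; rewrite -[i in iota i]addn0 iotaDl -map_comp.
rewrite (eq_map (g := nth 0 (drop i v))) => [|j]; last by rewrite /= nth_drop.
have sd : size (drop i v) = k by rewrite size_drop sv addKn.
by rewrite map_nth_iota0 ?sd // -[X in take X]sd take_size.
Qed.

Lemma computable_rec k B S N :
  computable k B -> computable k.+2 S -> computable k N ->
  computable k (fun O v => nat_rect _ (B O v) (fun i a => S O [:: i, a & v]) (N O v)).
Proof.
move=> [PB hB] [PS hS] hN.
have [gs gsE] : exists gs, forall O v, size v = k -> evals O gs v (N O v :: v).
  have [|gs gsE] := @all_computable_evals k (N :: [seq (fun _ v => nth 0 v j) | j <- iota 0 k]).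
    by split=> //; apply: all_computable_vars.
  exists gs => O v sv; have := gsE O v sv; rewrite /= -map_comp.
  by rewrite map_nth_iota_drop // drop0.
exists (PComp (PPrec PB PS) gs) => O v sv; apply: (ev_comp (gsE O v sv)).
elim: (N O v) => [|n IHn] /=; first by apply: ev_prec0; apply: hB.
by apply: (ev_precS IHn); apply: hS; rewrite /= sv.
Qed.

Lemma computable1 (f : nat -> nat) : computable 1 (fun _ v => f (nth 0 v 0)) ->
  forall k F, computable k F -> computable k (fun O v => f (F O v)).
Proof. by move=> hf k F hF; apply: (computable_comp (Fs := [:: F]) hf). Qed.

Lemma computable2 (f : nat -> nat -> nat) :
    computable 2 (fun _ v => f (nth 0 v 0) (nth 0 v 1)) ->
  forall k F G, computable k F -> computable k G ->
  computable k (fun O v => f (F O v) (G O v)).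
Proof. by move=> hf k F G hF hG; apply: (computable_comp (Fs := [:: F; G]) hf). Qed.

Lemma computable_oracle1 (f : oracle -> nat -> nat) :
    computable 1 (fun O v => f O (nth 0 v 0)) ->
  forall k F, computable k F -> computable k (fun O v => f O (F O v)).
Proof. by move=> hf k F hF; apply: (computable_comp (Fs := [:: F]) hf). Qed.

Create HintDb comp.
#[local] Hint Resolve computable_var computable_const computable_succ computable_oracle : comp.

Lemma computable_add k F G : computable k F -> computable k G ->
  computable k (fun O v => F O v + G O v).
Proof.
apply: computable2; apply: computable_ext (computable_rec (S := fun _ v => (nth 0 v 1).+1)
  (computable_var 2 0) _ (computable_var 2 1)); last by auto with comp.
by move=> O v _; elim: (nth 0 v 1) => [|n /= ->]; rewrite ?addn0 ?addnS.
Qed.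
#[local] Hint Resolve computable_add : comp.

Lemma computable_mul k F G : computable k F -> computable k G ->
  computable k (fun O v => F O v * G O v).
Proof.
apply: computable2; apply: computable_ext (computable_rec (S := fun _ v => nth 0 v 2 + nth 0 v 1)
  (computable_const 2 0) _ (computable_var 2 1)); last by auto with comp.
by move=> O v _; elim: (nth 0 v 1) => [|n /= ->]; rewrite ?muln0 ?mulnS.
Qed.

Lemma computable_pred k F : computable k F -> computable k (fun O v => (F O v).-1).
Proof.
apply: computable1; apply: computable_ext (computable_rec (S := fun _ v => nth 0 v 0)
  (computable_const 1 0) _ (computable_var 1 0)); last by auto with comp.
by move=> O v _; case: (nth 0 v 0).
Qed.
#[local] Hint Resolve computable_mul computable_pred : comp.

Lemma computable_sub k F G : computable k F -> computable k G ->
  computable k (fun O v => F O v - G O v).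
Proof.
apply: computable2; apply: computable_ext (computable_rec (S := fun _ v => (nth 0 v 1).-1)
  (computable_var 2 0) _ (computable_var 2 1)); last by auto with comp.
by move=> O v _; elim: (nth 0 v 1) => [|n /= ->]; rewrite ?subn0 ?subnS.
Qed.
#[local] Hint Resolve computable_sub : comp.

Lemma computable_exp2 k F : computable k F -> computable k (fun O v => 2 ^ F O v).
Proof.
apply: computable1; apply: computable_ext (computable_rec (S := fun _ v => 2 * nth 0 v 1)
  (computable_const 1 1) _ (computable_var 1 0)); last by auto with comp.
by move=> O v _; elim: (nth 0 v 0) => [|n /= ->]; rewrite ?expnS.
Qed.

Lemma computable_negb k (B : oracle -> seq nat -> bool) :
  computable k (fun O v => B O v) -> computable k (fun O v => ~~ B O v).
Proof.
move=> hB; apply: (computable_ext (F := fun O v => 1 - B O v)); last by auto with comp.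
by move=> O v _; case: (B O v).
Qed.

Lemma computable_andb k (B C : oracle -> seq nat -> bool) :
  computable k (fun O v => B O v) -> computable k (fun O v => C O v) ->
  computable k (fun O v => B O v && C O v).
Proof.
move=> hB hC; apply: (computable_ext (F := fun O v => B O v * C O v)); last by auto with comp.
by move=> O v _; rewrite mulnb.
Qed.
#[local] Hint Resolve computable_exp2 computable_negb computable_andb : comp.

Lemma computable_leq k F G : computable k F -> computable k G ->
  computable k (fun O v => F O v <= G O v).
Proof.
move=> hF hG; apply: (computable_ext (F := fun O v => 1 - (F O v - G O v))); last by auto with comp.
by move=> O v _; rewrite /leq; case: (_ - G O v).
Qed.
#[local] Hint Resolve computable_leq : comp.

Lemma computable_eqn k F G : computable k F -> computable k G ->
  computable k (fun O v => F O v == G O v).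
Proof.
move=> hF hG; apply: (computable_ext (F := fun O v => (F O v <= G O v) && (G O v <= F O v))).
  by move=> O v _; rewrite -eqn_leq.
by auto with comp.
Qed.
#[local] Hint Resolve computable_eqn : comp.

(** Halving is primitive recursive because [n.+1./2 = n - n./2]. *)
Lemma computable_half k F : computable k F -> computable k (fun O v => (F O v)./2).
Proof.
apply: computable1; apply: computable_ext (computable_rec (S := fun _ v => nth 0 v 0 - nth 0 v 1)
  (computable_const 1 0) _ (computable_var 1 0)); last by auto with comp.
move=> O v _; elim: (nth 0 v 0) => //= n ->.
by rewrite -{1}[n]odd_double_half uphalf_half -addnn addnA addnK.
Qed.
#[local] Hint Resolve computable_half : comp.

Lemma computable_odd k F : computable k F -> computable k (fun O v => odd (F O v)).
Proof.
move=> hF; apply: (computable_ext (F := fun O v => F O v - 2 * (F O v)./2)); last by auto with comp.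
by move=> O v _; rewrite -{1}[F O v]odd_double_half mul2n addnK.
Qed.
#[local] Hint Resolve computable_odd : comp.

Lemma computable_iter_half k N F : computable k N -> computable k F ->
  computable k (fun O v => iter (N O v) half (F O v)).
Proof.
apply: (computable2 (f := fun n x => iter n half x)).
apply: computable_ext (computable_rec (S := fun _ v => (nth 0 v 1)./2)
  (computable_var 2 1) _ (computable_var 2 0)); last by auto with comp.
by move=> O v _; elim: (nth 0 v 0) => //= n ->.
Qed.
#[local] Hint Resolve computable_iter_half : comp.

(** Substitutes into the leading arguments and passes the others through unchanged, as required by
    the bodies of sums and recursions, which see counters in front of the parameters. *)
Lemma computable_comp_drop i k G Fs :
  computable (size Fs + k) G -> all_computable (i + k) Fs ->
  computable (i + k) (fun O v => G O ([seq F O v | F <- Fs] ++ drop i v)).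
Proof.
move=> hG hF; apply: computable_ext (computable_comp (k := i + k)
  (Fs := Fs ++ [seq (fun (_ : oracle) v => nth 0 v j) | j <- iota i k]) hG _ _).
- by move=> O v sv; rewrite map_cat -map_comp -(map_nth_iota_drop sv).
- by rewrite size_cat size_map size_iota.
- elim: Fs hF {hG} => [_|F Fs IH /= [hF /IH]] //=; exact: all_computable_vars.
Qed.

Lemma computable_sum k G N : computable k.+1 G -> computable k N ->
  computable k (fun O v => \sum_(i < N O v) G O (val i :: v)).
Proof.
move=> hG hN; apply: computable_ext
  (computable_rec (S := fun O w => nth 0 w 1 + G O (nth 0 w 0 :: drop 2 w))
   (computable_const k 0) _ hN); last first.
  apply: computable_add; first exact: computable_var.
  apply: (computable_comp_drop (i := 2) (Fs := [:: fun _ w => nth 0 w 0])) => //.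
  by split; first exact: computable_var.
move=> O v _; elim: (N O v) => [|n /= ->]; first by rewrite big_ord0.
by rewrite big_ord_recr drop0.
Qed.

(** * Step-bounded evaluation *)

Fixpoint all_progs (P : prog -> Prop) (s : list prog) : Prop :=
  if s is e :: s' then P e /\ all_progs P s' else True.

Lemma prog_ind_nested (P : prog -> Prop) :
  P PZero -> P PSucc -> (forall i, P (PProj i)) ->
  (forall f gs, P f -> all_progs P gs -> P (PComp f gs)) ->
  (forall f g, P f -> P g -> P (PPrec f g)) ->
  (forall f, P f -> P (PMu f)) -> P POracle -> forall e, P e.
Proof.
move=> h0 hS hp hc hr hm ho; fix IH 1; case=> [||i|f gs|f g|f|].
- exact: h0.
- exact: hS.
- exact: hp.
- apply: hc; first exact: IH.
  by elim: gs => [|g gs IHgs]; [| split; [exact: IH | exact: IHgs]].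
- by apply: hr; apply: IH.
- by apply: hm; apply: IH.
- exact: ho.
Qed.

Definition monotone_clock (F : oracle -> nat -> seq nat -> nat) : Prop :=
  forall O v t t' y, t <= t' -> F O t v = y.+1 -> F O t' v = y.+1.

Definition clocked k (F : oracle -> nat -> seq nat -> nat) : Prop :=
  computable k.+1 (fun O w => F O (nth 0 w 0) (behead w)) /\ monotone_clock F.

(* The value [0] means that the computation has not yet halted at time [t], and [y.+1]
   that it has halted with output [y]. With [b = false] the oracle given to the clock is
   ignored and the computation gets the empty one. *)
Definition clock_of (b : bool) k e (F : oracle -> nat -> seq nat -> nat) : Prop :=
  clocked k F /\ forall O v y, size v = k ->
    (eval (if b then O else emptyOracle) e v y <-> exists t, F O t v = y.+1).

Lemma clock_total b k e (G : oracle -> seq nat -> nat) :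
  computable k.+1 (fun O w => G O (behead w)) ->
  (forall O v y, eval (if b then O else emptyOracle) e v y <-> y = G O v) ->
  clock_of b k e (fun O t v => (G O v).+1).
Proof.
move=> hG hE; split; first by split=> //; apply: computable_succ.
move=> O v y _; split=> [/hE->|[t [<-]]]; first by exists 0.
exact/hE.
Qed.

Lemma clock_comp_args b k gs :
  all_progs (fun e => forall k, exists F, clock_of b k e F) gs ->
  exists Gs : seq (oracle -> nat -> seq nat -> nat),
    [/\ size Gs = size gs, foldr (fun G => and (clocked k G)) True Gs &
     forall O v w, size v = k -> (evals (if b then O else emptyOracle) gs v w <->
       exists t, [seq G O t v | G <- Gs] = [seq x.+1 | x <- w])].
Proof.
elim: gs => [_|g gs IH /= [hg /IH[Gs [sGs hGs eGs]]]].
  exists [::]; split=> // O v w _; split=> [ev|[t /=]].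
    by inversion ev; exists 0.
  by case: w => // _; constructor.
have [G [cG eG]] := hg k; exists (G :: Gs); split=> //=; first by rewrite sGs.
have mono t t' O v w : t <= t' -> [seq G O t v | G <- Gs] = [seq x.+1 | x <- w] ->
    [seq G O t' v | G <- Gs] = [seq x.+1 | x <- w].
  move=> le_tt.
  elim: Gs hGs w {sGs eGs} => [|G' Gs' IHG] //= [[_ mG] hG'] [|a w] //= [e1 e2].
  by rewrite (mG _ _ _ _ _ le_tt e1) (IHG hG' w e2).
move=> O v w sv; split=> [ev|[t]].
  inversion ev as [|g' gs' v' y w' ev1 ev2]; subst.
  have [t1 e1] := (eG _ _ _ erefl).1 ev1; have [t2 e2] := (eGs _ _ _ erefl).1 ev2.
  exists (maxn t1 t2) => /=.
  rewrite (mono _ _ _ _ _ (leq_maxr t1 t2) e2).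
  by rewrite (cG.2 _ _ _ _ _ (leq_maxl t1 t2) e1).
case: w => //= a w [e1 e2]; constructor.
  by apply/(eG _ _ _ sv); exists t.
by apply/(eGs _ _ _ sv); exists t.
Qed.

Lemma clock_comp b k f gs :
  (forall k, exists F, clock_of b k f F) ->
  all_progs (fun e => forall k, exists F, clock_of b k e F) gs ->
  exists F, clock_of b k (PComp f gs) F.
Proof.
move=> hf /(clock_comp_args k)[Gs [sGs hGs eGs]].
have [F [[cF mF] eF]] := hf (size Gs).
pose vals O t v := [seq G O t v | G : oracle -> nat -> seq nat -> nat <- Gs].
(* Until every argument has halted, [F] runs on meaningless predecessors of 0; the last factor masks
   its answer. *)
exists (fun O t v => F O t [seq x.-1 | x <- vals O t v] * all (fun x => 0 < x) (vals O t v)).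
have mono O v t t' : t <= t' -> all (fun x => 0 < x) (vals O t v) -> vals O t' v = vals O t v.
  move=> le_tt; rewrite /vals; elim: Gs hGs {sGs eGs cF mF eF vals} => //= G Gs IHG [[_ mG] hG].
  move=> /andP[G0 /(IHG hG)->].
  by rewrite (mG O v t t' (G O t v).-1) // prednK.
split; first split.
- apply: computable_mul.
    apply: computable_ext (computable_comp (k := k.+1) (Fs := (fun _ w => nth 0 w 0) ::
       [seq (fun O w => (G O (nth 0 w 0) (behead w)).-1) | G <- Gs]) cF _ _).
    + move=> O v _ /=; congr (F O _ _); rewrite /vals -!map_comp; exact: eq_map.
    + by rewrite /= size_map.
    + split; first exact: computable_var.
      elim: Gs hGs {sGs eGs cF mF eF vals mono} => //= G Gs IHG [[cG _] hG].
      by split; [apply: computable_pred | apply: IHG].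
  rewrite /vals; elim: Gs hGs {sGs eGs cF mF eF vals mono} => [_|G Gs IHG /= [[cG _] hG]].
    exact: computable_const.
  by apply: computable_andb; [apply: computable_leq => //; apply: computable_const | apply: IHG].
- move=> O v t t' y le_tt; case a: (all _ _); rewrite ?muln0 // muln1 => e1.
  by rewrite (mono _ _ _ _ le_tt a) a muln1; apply: mF le_tt e1.
move=> O v y sv; split=> [ev|[t]].
  inversion ev as [| | |f' gs' v' w y' ev1 ev2| | | |]; subst.
  have [t1 e1] := (eGs _ _ _ erefl).1 ev1.
  have sw : size w = size Gs by have := congr1 size e1; rewrite !size_map.
  have [t2 e2] := (eF _ _ _ sw).1 ev2.
  have a1 : all (fun x => 0 < x) (vals O t1 v).
    by rewrite /vals e1 all_map; apply/allP => x.
  exists (maxn t1 t2); rewrite (mono _ _ _ _ (leq_maxl t1 t2) a1) a1 muln1.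
  rewrite /vals e1 -map_comp map_id_in //.
  by apply: mF e2; apply: leq_maxr.
case a: (all _ _); rewrite ?muln0 // muln1 => e1.
apply: (@ev_comp _ _ _ _ [seq x.-1 | x <- vals O t v]).
  apply/(eGs _ _ _ sv); exists t; rewrite -map_comp map_id_in // => x xin /=.
  by rewrite prednK //; apply: (allP a).
by apply/eF; [rewrite !size_map | exists t].
Qed.

Lemma clock_prec b k f g :
  (forall k, exists F, clock_of b k f F) -> (forall k, exists F, clock_of b k g F) ->
  exists F, clock_of b k (PPrec f g) F.
Proof.
case: k => [|k] hf hg.
  exists (fun _ _ _ => 0); split; first by split=> //; apply: computable_const.
  move=> O [] // y _; split=> [ev|[]//]; inversion ev.
have [F [[cF mF] eF]] := hf k; have [G [[cG mG] eG]] := hg k.+2.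
pose R O t v n := nat_rect _ (F O t v)
  (fun i a => (0 < a) * G O t [:: i, a.-1 & v]) n.
exists (fun O t v => R O t (behead v) (nth 0 v 0)).
have mono O v n t t' y : t <= t' -> R O t v n = y.+1 -> R O t' v n = y.+1.
  move=> le_tt; elim: n y => [|n IHn] y /=; first exact: mF.
  case a: (R O t v n) => [|z] //=; rewrite mul1n => e1.
  by rewrite (IHn _ a) mul1n; apply: mG e1.
split; first split.
- apply: computable_ext (computable_rec (k := k.+2) (N := fun _ w => nth 0 w 1)
    (B := fun O w => F O (nth 0 w 0) (drop 2 w))
    (S := fun O w => (0 < nth 0 w 1) * G O (nth 0 w 2) [:: nth 0 w 0, (nth 0 w 1).-1 & drop 4 w])
    _ _ _); last exact: computable_var.
  + by move=> O [|t [|n v]] //= [sv]; rewrite !drop0.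
  + apply: (computable_comp_drop (i := 2) (Fs := [:: fun _ w => nth 0 w 0]) cF).
    by split; first exact: computable_var.
  + apply: computable_mul; first by auto with comp.
    apply: (computable_comp_drop (i := 4)
      (Fs := [:: fun _ w => nth 0 w 2; fun _ w => nth 0 w 0; fun _ w => (nth 0 w 1).-1]) cG).
    by do ! [split; first by auto with comp].
- by move=> O v t t' y; apply: mono.
move=> O [|n v] y //= [sv]; split.
  elim: n y => [|n IHn] y ev.
    inversion ev as [| | | |f' g' v' y' ev1| | |]; subst.
    by have [t e1] := (eF _ _ _ erefl).1 ev1; exists t.
  inversion ev as [| | | | |f' g' n' v' z y' ev1 ev2| |]; subst.
  have [t1 e1] := IHn _ ev1; have [t2 e2] := (eG O [:: n, z & v] y erefl).1 ev2.
  exists (maxn t1 t2) => /=; rewrite (mono _ _ _ _ _ _ (leq_maxl t1 t2) e1) mul1n.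
  by apply: mG e2; apply: leq_maxr.
move=> [t]; elim: n y => [|n IHn] y /=.
  by move=> e1; apply: ev_prec0; apply/(eF _ _ _ sv); exists t.
case a: (R O t v n) => [|z] //=; rewrite mul1n => e1.
apply: ev_precS (IHn _ a) _; apply/eG; first by rewrite /= sv.
by exists t.
Qed.

Lemma clock_mu b k f :
  (forall k, exists F, clock_of b k f F) -> exists F, clock_of b k (PMu f) F.
Proof.
move=> hf; have [F [[cF mF] eF]] := hf k.+1.
(* [0]: still searching; [1]: a value below is not known yet; [m.+2]: the least zero is
   [m]. *)
pose step O t v i a := if a is 0 then
   (if F O t (i :: v) is x.+1 then (if x is 0 then i.+2 else 0) else 1) else a.
pose R O t v n := nat_rect (fun _ => nat) 0 (step O t v) n.
(* The same [t] bounds the search and the running time of each test. The predecessor turns both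
   undecided states into 0 and the state [m.+2] into the clock value of output [m]. *)
exists (fun O t v => (R O t v t).-1).
have R0 O t v n : R O t v n = 0 <-> forall m, m < n -> 1 < F O t (m :: v).
  elim: n => [|n IHn] //=; rewrite /step; case a: (R O t v n) => [|z] //; last first.
    split=> // h; have : R O t v n = 0 by apply/IHn => m mn; apply/h/ltnW.
    by rewrite a.
  case e1: (F O t (n :: v)) => [|[|x]]; split=> // h.
  - by have := h n (ltnSn n); rewrite e1.
  - by have := h n (ltnSn n); rewrite e1.
  - move=> m; rewrite ltnS leq_eqVlt => /predU1P[->|]; first by rewrite e1.
    exact: (IHn.1 a).
have RS O t v n m : R O t v n = m.+2 <->
    [/\ m < n, F O t (m :: v) = 1 & forall j, j < m -> 1 < F O t (j :: v)].
  elim: n => [|n IHn]; first by split=> // - [].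
  rewrite /= /step; case a: (R O t v n) => [|z].
    have a' := (R0 _ _ _ _).1 a.
    case e1: (F O t (n :: v)) => [|[|x]]; split=> //.
    + move=> [mn Fm hm]; move: mn; rewrite ltnS leq_eqVlt => /predU1P[mn|mn].
        by rewrite mn e1 in Fm.
      by have := a' _ mn; rewrite Fm.
    + by move=> [<-].
    + move=> [mn Fm hm]; move: mn; rewrite ltnS leq_eqVlt => /predU1P[->//|mn].
      by have := a' _ mn; rewrite Fm.
    + move=> [mn Fm hm]; move: mn; rewrite ltnS leq_eqVlt => /predU1P[mn|mn].
        by rewrite mn e1 in Fm.
      by have := a' _ mn; rewrite Fm.
  rewrite -a IHn; split=> [[mn Fm hm]|[mn Fm hm]]; first by split=> //; apply: ltnW.
  split=> //; move: mn; rewrite ltnS leq_eqVlt => /predU1P[mn|//].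
  by have /R0 : forall j, j < n -> 1 < F O t (j :: v); [rewrite -mn | rewrite a].
have Rpred O t v y : (R O t v t).-1 = y.+1 <-> R O t v t = y.+2.
  by split=> [|->//]; case: (R O t v t) => //= n ->.
have mono1 O t t' v j : t <= t' -> 1 < F O t (j :: v) -> 1 < F O t' (j :: v).
  by move=> le_tt; case e1: (F O t _) => [|x] //= h; rewrite (mF _ _ _ _ _ le_tt e1).
split; first split.
- apply: computable_pred; apply: computable_ext (computable_rec (k := k.+1)
    (B := fun _ _ => 0) (N := fun _ w => nth 0 w 0)
    (S := fun O w => step O (nth 0 w 2) (drop 3 w) (nth 0 w 0) (nth 0 w 1)) _ _ _);
    try exact: computable_const; try exact: computable_var.
    by move=> O [|t v] //= [sv]; rewrite !drop0.
  have cF' : computable k.+3 (fun O w => F O (nth 0 w 2) (nth 0 w 0 :: drop 3 w)).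
    apply: (computable_comp_drop (i := 3)
      (Fs := [:: fun _ w => nth 0 w 2; fun _ w => nth 0 w 0]) cF).
    by do ! [split; first by auto with comp].
  apply: (computable_ext (F := fun O w => nth 0 w 1 + (nth 0 w 1 == 0) *
      ((F O (nth 0 w 2) (nth 0 w 0 :: drop 3 w) == 0)
       + (F O (nth 0 w 2) (nth 0 w 0 :: drop 3 w) == 1) * (nth 0 w 0).+2))); last by auto 9 with comp.
  move=> O w _; rewrite /step; case: (nth 0 w 1) => [|a] /=; last by rewrite mul0n addn0.
  by case: (F O _ _) => [|[|x]]; rewrite /= ?mul1n ?mul0n.
- move=> O v t t' y le_tt /Rpred/RS[yt Fy hy]; apply/Rpred/RS; split.
  + exact: leq_trans yt le_tt.
  + exact: mF Fy.
  + by move=> j /hy; apply: mono1.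
move=> O v y sv; split=> [ev|[t /Rpred/RS[_ Fy hy]]].
  inversion ev as [| | | | | |f' v' n ev1 ev2|]; subst.
  have [t1 e1] := (eF O (y :: v) 0 erefl).1 ev1.
  have [t2 e2] : exists t, forall m, m < y -> 1 < F O t (m :: v).
    elim: {-2}y (leqnn y) => [|n IHn] ny; first by exists 0.
    have [t2 e2] := IHn (ltnW ny); have [x /(eF O (n :: v) x.+1 erefl)[t3 e3]] := ev2 n ny.
    exists (maxn t2 t3) => m; rewrite ltnS leq_eqVlt => /predU1P[->|mn].
      by rewrite (mF _ _ _ _ _ (leq_maxr t2 t3) e3).
    by apply: (mono1 _ t2); [apply: leq_maxl | apply: e2].
  exists (maxn y.+1 (maxn t1 t2)); apply/Rpred/RS; split.
  - exact: leq_maxl.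
  - by apply: mF e1; rewrite leq_max [X in _ || X]leq_max leqnn orbT.
  - by move=> j /e2; apply: mono1; rewrite !leq_max leqnn !orbT.
apply: ev_mu; first by apply/eF; [rewrite /= sv | exists t].
move=> m /hy; case e1: (F O t (m :: v)) => [|[|x]] // _.
by exists x; apply/eF; [rewrite /= sv | exists t].
Qed.

Lemma clock_exists b e : forall k, exists F, clock_of b k e F.
Proof.
elim/prog_ind_nested: e => [||i|f gs hf hgs|f g hf hg|f hf|] k.
- exists (fun O t v => 1); apply: (clock_total (G := fun _ _ => 0)).
    exact: computable_const.
  by move=> O v y; split=> [ev|->]; [inversion ev | constructor].
- exists (fun O t v => (nth 0 v 0).+2); apply: (clock_total (G := fun _ v => (nth 0 v 0).+1)).
    apply: (computable_ext (F := fun _ w => (nth 0 w 1).+1)); last by auto with comp.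
    by move=> O v _; rewrite nth_behead.
  by move=> O v y; split=> [ev|->]; [inversion ev | constructor].
- exists (fun O t v => (nth 0 v i).+1); apply: (clock_total (G := fun _ v => nth 0 v i)).
    apply: (computable_ext (F := fun _ w => nth 0 w i.+1)); last by auto with comp.
    by move=> O v _; rewrite nth_behead.
  by move=> O v y; split=> [ev|->]; [inversion ev | constructor].
- exact: clock_comp.
- exact: clock_prec.
- exact: clock_mu.
- exists (fun O t v => (code_ans ((if b then O else emptyOracle) (nth 0 v 0))).+1).
  apply: (clock_total (G := fun O v => code_ans ((if b then O else emptyOracle) (nth 0 v 0)))).
    case: b; last exact: (computable_const _ 0).
    apply: (computable_ext (F := fun O w => code_ans (O (nth 0 w 1)))); last by auto with comp.
    by move=> O v _; rewrite nth_behead.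
  by move=> O v y; split=> [ev|->]; [inversion ev | constructor].
Qed.

Lemma clock1 b e : exists F : oracle -> nat -> nat -> nat,
  [/\ forall k T X, computable k T -> computable k X ->
        computable k (fun O v => F O (T O v) (X O v)),
      forall O t t' n y, t <= t' -> F O t n = y.+1 -> F O t' n = y.+1 &
      forall O n y, eval (if b then O else emptyOracle) e [:: n] y <-> exists t, F O t n = y.+1].
Proof.
have [F [[cF mF] eF]] := clock_exists b e 1.
exists (fun O t n => F O t [:: n]); split.
- move=> k T X hT hX.
  by apply: (computable_comp (Fs := [:: T; X]) cF) => //; split=> //; split.
- by move=> O t t' n y; apply: mF.
- by move=> O n y; apply: eF.
Qed.


(** Determinism is read off the clock: both outputs are still present at a common later time. *)
Lemma eval_functional O e v y z : eval O e v y -> eval O e v z -> y = z.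
Proof.
have [F [[_ mF] eF]] := clock_exists true e (size v).
move=> /(eF O v y erefl)[t1 e1] /(eF O v z erefl)[t2 e2].
have := mF _ _ _ _ _ (leq_maxl t1 t2) e1.
by rewrite (mF _ _ _ _ _ (leq_maxr t1 t2) e2) => -[].
Qed.

(** * Strings, cylinders and the Kraft inequality *)

(** In binary, [(str2nat s).+1] is a leading 1 followed by the bits of [s], the head of [s] being
    the lowest bit. This is why codes are mostly handled through their successors. *)
Lemma str2nat_consS b s : (str2nat (b :: s)).+1 = b + (str2nat s).+1.*2.
Proof. by rewrite /= addn1 doubleS; case: b; rewrite ?addn1 ?addn0. Qed.

Lemma half_str2natS b s : (str2nat (b :: s)).+1./2 = (str2nat s).+1.
Proof. by rewrite str2nat_consS half_bit_double. Qed.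

Lemma odd_str2natS b s : odd (str2nat (b :: s)).+1 = b.
Proof. by rewrite str2nat_consS oddD odd_double addbF oddb. Qed.

Lemma str2nat_inj : injective str2nat.
Proof.
elim=> [|a s IHs] [|b t] // e; try by move: e; rewrite /= addn1.
have [est] : (str2nat s).+1 = (str2nat t).+1.
  by rewrite -(half_str2natS a s) -(half_str2natS b t) e.
by rewrite (IHs _ est) -(odd_str2natS a s) -(odd_str2natS b t) e.
Qed.

Lemma str2nat_surj n : exists s, str2nat s == n.
Proof.
elim/ltn_ind: n => [[|n]] IHn; first by exists [::].
have [|s /eqP es] := IHn n./2; first by lia.
by exists (odd n :: s); rewrite /= es addn1 addSn addnC odd_double_half.
Qed.

Definition nat2str n : seq bool := xchoose (str2nat_surj n).

Lemma nat2strK : cancel nat2str str2nat.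
Proof. by move=> n; apply/eqP; exact: (xchooseP (str2nat_surj n)). Qed.

Lemma str2natK : cancel str2nat nat2str.
Proof. by move=> s; apply: str2nat_inj; rewrite nat2strK. Qed.

Definition codesize n := size (nat2str n).

Lemma str2nat_bounds s : 2 ^ size s <= (str2nat s).+1 < 2 ^ (size s).+1.
Proof.
elim: s => [|b s]; first by [].
rewrite str2nat_consS [size (b :: s)]/= [2 ^ (size s).+2]expnS.
by rewrite [2 ^ (size s).+1]expnS; case: b; lia.
Qed.

Lemma leq_codesize n m : (n <= codesize m) = (2 ^ n <= m.+1).
Proof.
have /andP[lo hi] := str2nat_bounds (nat2str m); rewrite nat2strK in lo hi.
apply/idP/idP => [le_nm|le_nm]; first by apply: leq_trans lo; rewrite leq_exp2l.
by rewrite -ltnS -(ltn_exp2l _ _ (isT : 1 < 2)); apply: leq_ltn_trans hi.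
Qed.

Lemma leq_codesize2 m n : m <= n -> codesize m <= codesize n.
Proof.
move=> le_mn; rewrite leq_codesize; apply: (leq_trans (n := m.+1)) => //.
by rewrite -leq_codesize.
Qed.

Lemma codesize_leq n : codesize n <= n.
Proof.
have := leq_codesize (codesize n) n; rewrite leqnn => /esym h.
by rewrite -ltnS; apply: leq_trans h; apply: ltn_expl.
Qed.

(** Turns a threshold into a sum of truth values, so that lengths and 2-adic valuations become
    computable by bounded sums. *)
Lemma sum_ltn n m : \sum_(i < n) (i < m) = minn n m.
Proof.
elim: n => [|n IHn]; first by rewrite big_ord0 min0n.
by rewrite big_ord_recr /= IHn; case: ltnP; lia.
Qed.

Lemma computable_codesize k F :
  computable k F -> computable k (fun O v => codesize (F O v)).
Proof.
apply: computable1; apply: (computable_ext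
  (F := fun _ v => \sum_(i < nth 0 v 0) (2 ^ (val i).+1 <= (nth 0 v 0).+1))).
  move=> O v _; move: (nth 0 v 0) => m.
  under eq_bigr => i _ do rewrite -leq_codesize.
  by rewrite sum_ltn; apply/minn_idPr/codesize_leq.
apply: (computable_sum (G := fun _ w => 2 ^ (nth 0 w 0).+1 <= (nth 0 w 1).+1)); auto with comp.
Qed.

(* The cylinder of the string [s] is the interval between [bval s / 2 ^ size s] and
   [(bval s).+1 / 2 ^ size s]. *)
Fixpoint bval (s : seq bool) : nat :=
  if s is b :: s' then b * 2 ^ size s' + bval s' else 0.

Lemma bval_lt s : bval s < 2 ^ size s.
Proof. by elim: s => [|b s IHs] //=; rewrite expnS; case: b; lia. Qed.

Lemma bval_cat p r : bval (p ++ r) = bval p * 2 ^ size r + bval r.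
Proof. by elim: p => [|b p IHp] //=; rewrite IHp size_cat expnD; lia. Qed.

Lemma bval_surj n v : v < 2 ^ n -> exists2 s, size s = n & bval s = v.
Proof.
elim: n v => [|n IHn] v; first by case: v => // _; exists [::].
rewrite expnS => lt_v; have [lo|hi] := ltnP v (2 ^ n).
  by have [s <- <-] := IHn v lo; exists (false :: s).
have [|s sn sv] := IHn (v - 2 ^ n); first by lia.
by exists (true :: s); rewrite /= sn ?sv //; lia.
Qed.

Lemma bval_inj p q : size p = size q -> bval p = bval q -> p = q.
Proof.
elim: p q => [|a p IHp] [|b q] //= [spq].
have := bval_lt p; have := bval_lt q; rewrite spq => hq hp.
case: a; case: b => /= e; try lia; by rewrite (IHp q) //; lia.
Qed.

Definition codeval n := bval (nat2str n).

(** The head of a string is the lowest bit of its code but the highest bit of its [bval], so the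
    bits of [m.+1] below the leading one are taken in reverse order. *)
Lemma codeval_sum m : codeval m =
  \sum_(i < codesize m) odd (iter i half m.+1) * 2 ^ ((codesize m).-1 - i).
Proof.
rewrite -(nat2strK m) /codeval /codesize str2natK; elim: (nat2str m) => [|b s IHs].
  by rewrite big_ord0.
rewrite [size _]/= big_ord_recl subn0 /=; congr (_ + _).
  by have := odd_str2natS b s => /= ->.
rewrite IHs; apply: eq_bigr => i _; rewrite /bump /= add1n.
congr (odd _ * 2 ^ _); last by lia.
by rewrite -iterS iterSr half_str2natS.
Qed.

Lemma computable_codeval k F :
  computable k F -> computable k (fun O v => codeval (F O v)).
Proof.
apply: computable1; apply: (computable_ext (F := fun _ v =>
  \sum_(i < codesize (nth 0 v 0)) odd (iter (val i) half (nth 0 v 0).+1)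
     * 2 ^ ((codesize (nth 0 v 0)).-1 - val i))).
  by move=> O v _; rewrite codeval_sum.
have hs k' := @computable_codesize k' _ (computable_var _ _).
apply: (computable_sum (G := fun _ w => odd (iter (nth 0 w 0) half (nth 0 w 1).+1)
     * 2 ^ ((codesize (nth 0 w 1)).-1 - nth 0 w 0))); auto 9 with comp.
Qed.
#[local] Hint Resolve computable_codesize computable_codeval : comp.

Local Open Scope ring_scope.

Lemma pow2_gt0 n : 0 < 2%:R ^- n :> rat.
Proof. by rewrite invr_gt0 exprn_gt0. Qed.

Lemma pow2_ge0 n : 0 <= 2%:R ^- n :> rat.
Proof. exact: ltW (pow2_gt0 n). Qed.

Lemma pow2S n : 2%:R ^- n = 2%:R * 2%:R ^- n.+1 :> rat.
Proof. by rewrite exprS invfM mulrA divff ?mul1r. Qed.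

Lemma pow2_sub m n : (m <= n)%N -> 2%:R ^+ (n - m) = 2%:R ^+ n * 2%:R ^- m :> rat.
Proof. by move=> mn; rewrite -{2}(subnK mn) exprD mulfK ?expf_neq0. Qed.

Definition antichain (D : pred (seq bool)) : Prop :=
  forall p q, D p -> D q -> prefix p q -> p = q.

(** Induction on the maximal length: an antichain without the empty string splits by first bit into
    two antichains of tails, and each half enters with factor 1/2. *)
Lemma kraft_seq (s : seq (seq bool)) : uniq s -> antichain (mem s) ->
  \sum_(p <- s) 2%:R ^- size p <= 1 :> rat.
Proof.
move: {2}(\max_(p <- s) size p) (leqnn (\max_(p <- s) size p)) => L.
have nilcase t : uniq t -> antichain (mem t) -> [::] \in t -> t = [:: [::]].
  move=> ut at0 nt; apply: perm_small_eq => //; apply: uniq_perm => // p.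
  rewrite inE; apply/idP/eqP => [pt|->//]; symmetry.
  exact: (at0 [::] p nt pt (prefix0s p)).
elim: L s => [|L IHL] s hL us ha; have [/(nilcase s us ha)->|ns] := boolP ([::] \in s);
  try by rewrite big_seq1 expr0 invr1.
  case: s hL us ha ns => [|p s]; first by rewrite !big_nil.
  rewrite big_cons geq_max => /andP[]; case: p => //= _ _ _ _; by rewrite inE.
(* The default [~~ b] keeps the empty string out of [tl b]. *)
pose tl b := [seq behead p | p <- s & head (~~ b) p == b].
have mem_tl b p : (p \in tl b) = (b :: p \in s).
  apply/mapP/idP => [[[|a q]]|ps]; rewrite ?mem_filter /=.
  - by case: b.
  - by move=> /andP[/eqP<- qs] ->.
  - by exists (b :: p); rewrite ?mem_filter /= ?eqxx.
have tlP b : \sum_(p <- tl b) 2%:R ^- size p <= 1 :> rat.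
  apply: IHL.
  - apply/bigmax_leqP_seq => p; rewrite mem_tl => pb _.
    by have /bigmax_leqP_seq/(_ _ pb isT) := hL.
  - rewrite map_inj_in_uniq ?filter_uniq // => p q.
    rewrite !mem_filter => /andP[hp ps] /andP[hq qs].
    case: p hp ps => [|a p] /=; first by case: (b).
    move=> /eqP-> ps; case: q hq qs => [|c q] /=; first by case: (b).
    by move=> /eqP-> _ ->.
  - move=> p q; rewrite /= !mem_tl => pb qb pq.
    by have [] : b :: p = b :: q by apply: ha; rewrite //= eqxx.
have -> : \sum_(p <- s) 2%:R ^- size p =
    (\sum_(p <- tl true) 2%:R ^- size p + \sum_(p <- tl false) 2%:R ^- size p) / 2%:R :> rat.
  rewrite mulrDl !mulr_suml !big_map !big_filter (bigID (fun p => head false p == true)) /=.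
  congr (_ + _).
    by apply: eq_bigr => -[|a p] //= _; rewrite exprS invfM mulrC.
  rewrite big_seq_cond [RHS]big_seq_cond; apply: eq_big => -[|a p] /=.
  - by rewrite (negbTE ns).
  - by case: a.
  - by rewrite (negbTE ns).
  - by move=> _; rewrite exprS invfM mulrC.
by have := tlP true; have := tlP false; lra.
Qed.

Lemma kraft (D : pred nat) n : antichain (fun p => D (str2nat p)) ->
  \sum_(m < n | D m) 2%:R ^- codesize m <= 1 :> rat.
Proof.
move=> aD; have := @kraft_seq [seq nat2str m | m <- iota 0 n & D m].
rewrite -(big_mkord D (fun m => 2%:R ^- codesize m)) /index_iota subn0.
rewrite big_map big_filter; apply.
  by rewrite map_inj_uniq ?filter_uniq ?iota_uniq //; apply: can_inj nat2strK.
move=> p q /= /mapP[a]; rewrite mem_filter => /andP[Da _ ->].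
move=> /mapP[b]; rewrite mem_filter => /andP[Db _ ->].
by apply: aD; rewrite nat2strK.
Qed.

(** * Kraft-Chaitin coding *)

Local Open Scope nat_scope.

Lemma evals1 O g v w : evals O [:: g] v w -> exists2 y, w = [:: y] & eval O g v y.
Proof.
move=> ev; inversion ev as [|g' gs v' y w' e1 e2]; subst.
by inversion e2; subst; exists y.
Qed.

Section KraftChaitin.

(** Request [i] is present when [act O i] holds; it asks for a code of weight [2 ^- len O i], up to
    a factor of two, on which the machine outputs [out O i]. Absent indices weigh nothing, so a
    decidable family of requests needs no renumbering. *)
Variables (act : oracle -> nat -> bool) (len out : oracle -> nat -> nat).

(** [2 ^ total_len O i] is a common denominator of the weights before [i]; it turns comparisons of
    rationals into integer ones that a program can perform. *)
Definition total_len O i := \sum_(j < i) len O j.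

Definition scaled_sum O i := \sum_(j < i) act O j * 2 ^ (total_len O i - len O j).

(* The code of request [i] is the leftmost string of length [(len O i).+1] whose
   cylinder starts at or after the sum of the weights of the previous requests; that
   cylinder has half the weight of the request, so it ends before the next partial sum. *)
Definition is_code O i m : bool :=
  (act O i && ((len O i).+1 == codesize m)) &&
  ((scaled_sum O i * 2 ^ codesize m <= codeval m * 2 ^ total_len O i) &&
   ((codeval m * 2 ^ total_len O i).+1 <= scaled_sum O i * 2 ^ codesize m + 2 ^ total_len O i)).

Lemma computable_is_code :
  computable 1 (fun O v => act O (nth 0 v 0)) ->
  computable 1 (fun O v => len O (nth 0 v 0)) ->
  computable 2 (fun O v => is_code O (nth 0 v 0) (nth 0 v 1)).
Proof.
move=> /(computable_oracle1 (f := fun O i => act O i)) hact /computable_oracle1 hlen.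
have htot : computable 1 (fun O v => total_len O (nth 0 v 0)).
  by apply: (computable_sum (G := fun O w => len O (nth 0 w 0))); auto with comp.
move: htot => /computable_oracle1 htot.
have hsum : computable 1 (fun O v => scaled_sum O (nth 0 v 0)).
  apply: (computable_sum (G := fun O w => act O (nth 0 w 0) *
    2 ^ (total_len O (nth 0 w 1) - len O (nth 0 w 0)))); auto 9 with comp.
move: hsum => /computable_oracle1 hsum.
rewrite /is_code; auto 12 with comp.
Qed.

Local Open Scope ring_scope.

Definition partial_sum O i : rat := \sum_(j < i | act O j) 2%:R ^- len O j.

Lemma scaled_sumE O i : (scaled_sum O i)%:R = partial_sum O i * 2%:R ^+ total_len O i.
Proof.
rewrite /scaled_sum /partial_sum natr_sum big_distrl [RHS]big_mkcond /=.
apply: eq_bigr => j _; case: (act O j); rewrite ?mul0n // mul1n natrX mulrC.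
by rewrite -pow2_sub // /total_len (bigD1 j) //= leq_addr.
Qed.

Lemma is_codeP O i m : reflect
  [/\ act O i, (len O i).+1 = codesize m,
      partial_sum O i <= (codeval m)%:R * 2%:R ^- codesize m &
      (codeval m)%:R * 2%:R ^- codesize m < partial_sum O i + 2%:R ^- codesize m]
  (is_code O i m).
Proof.
have D0 : 0 < 2%:R ^+ total_len O i :> rat by rewrite exprn_gt0.
have n0 : 0 < 2%:R ^+ codesize m :> rat by rewrite exprn_gt0.
have lo : (scaled_sum O i * 2 ^ codesize m <= codeval m * 2 ^ total_len O i)%N =
    (partial_sum O i <= (codeval m)%:R * 2%:R ^- codesize m).
  rewrite -(ler_nat rat) !natrM !natrX scaled_sumE mulrAC ler_pM2r //.
  by rewrite ler_pdivlMr.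
have hi : (codeval m * 2 ^ total_len O i < scaled_sum O i * 2 ^ codesize m + 2 ^ total_len O i)%N =
    ((codeval m)%:R * 2%:R ^- codesize m < partial_sum O i + 2%:R ^- codesize m).
  rewrite -(ltr_nat rat) natrD !natrM !natrX scaled_sumE mulrAC.
  rewrite -[X in _ + X]mul1r -mulrDl ltr_pM2r // ltr_pdivrMr //.
  by rewrite mulrDl mulVf // gt_eqF.
rewrite /is_code lo hi; apply: (iffP andP).
  by move=> [/andP[-> /eqP->] /andP[-> ->]].
by move=> [-> -> -> ->]; rewrite eqxx.
Qed.

Lemma partial_sumS O i : partial_sum O i.+1 = partial_sum O i + (if act O i then 2%:R ^- len O i else 0).
Proof. by rewrite /partial_sum big_mkcond big_ord_recr /= -big_mkcond. Qed.

Lemma partial_sum_le O i j : (i <= j)%N -> partial_sum O i <= partial_sum O j.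
Proof.
elim: j => [|j IHj]; first by rewrite leqn0 => /eqP->.
rewrite leq_eqVlt => /predU1P[->//|/IHj h]; apply: le_trans h _.
by rewrite partial_sumS lerDl; case: ifP => // _; apply: pow2_ge0.
Qed.

Lemma is_code_gap O i j m m' : (i < j)%N -> is_code O i m -> is_code O j m' ->
  ((codeval m).+1)%:R * 2%:R ^- codesize m < (codeval m')%:R * 2%:R ^- codesize m' :> rat.
Proof.
move=> lt_ij /is_codeP[ai ln lo hi] /is_codeP[_ _ lo' _].
apply: lt_le_trans lo'; apply: lt_le_trans (partial_sum_le O lt_ij).
rewrite partial_sumS ai (pow2S (len O i)) ln -natr1 mulrDl mul1r.
by move: hi; lra.
Qed.

Lemma prefix_bounds p q : prefix p q ->
  (bval p)%:R * 2%:R ^- size p <= (bval q)%:R * 2%:R ^- size q :> rat /\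
  (bval q)%:R * 2%:R ^- size q < (bval p).+1%:R * 2%:R ^- size p :> rat.
Proof.
move=> /prefixP[r ->]; rewrite bval_cat size_cat exprD invfM mulrA.
have n0 : 0 < 2%:R ^+ size r :> rat by rewrite exprn_gt0.
have e : (bval p * 2 ^ size r + bval r)%:R / 2%:R ^+ size p / 2%:R ^+ size r =
    ((bval p)%:R + (bval r)%:R / 2%:R ^+ size r) * 2%:R ^- size p :> rat.
  rewrite mulrAC natrD natrM natrX [X in X / _ = _]mulrDl mulfK //.
  by rewrite gt_eqF.
have r1 : (bval r)%:R / 2%:R ^+ size r < 1 :> rat.
  by rewrite ltr_pdivrMr // mul1r -natrX ltr_nat bval_lt.
have r0 : 0 <= (bval r)%:R / 2%:R ^+ size r :> rat.
  by rewrite divr_ge0 ?ler0n // ltW.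
rewrite e ler_pM2r ?ltr_pM2r ?pow2_gt0 // -natr1; split; lra.
Qed.

(** Codes of different requests have disjoint cylinders, laid out from left to right. For a single
    request, the admissible left endpoints form a half-open interval of length [2 ^- n], which
    contains only one multiple of [2 ^- n]. *)
Lemma is_code_antichain O i j p q : is_code O i (str2nat p) -> is_code O j (str2nat q) ->
  prefix p q -> p = q.
Proof.
rewrite /codeval; case: (ltngtP i j) => [lt_ij|lt_ji|<-] ci cj /prefix_bounds[lo hi].
- have := is_code_gap lt_ij ci cj; rewrite /codesize /codeval !str2natK.
  by move=> h; have := lt_trans h hi; rewrite ltxx.
- have := is_code_gap lt_ji cj ci; rewrite /codesize /codeval !str2natK -natr1 mulrDl mul1r.
  by move=> h; have := lt_le_trans h lo; rewrite ltNge lerDl pow2_ge0.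
move: ci cj => /is_codeP[_ lp lop hip] /is_codeP[_ lq loq hiq].
move: lp lq lop hip loq hiq; rewrite /codesize /codeval !str2natK => lp lq.
rewrite -lp -lq => h1 h2 h3 h4; apply: bval_inj; first by rewrite -lp -lq.
have p0 := pow2_gt0 (len O i).+1.
apply/eqP; rewrite eqn_leq -!(ler_nat rat) leNgt [X in _ && X]leNgt.
have gap a b : (a < b)%N -> a%:R * 2%:R ^- (len O i).+1 + 2%:R ^- (len O i).+1
     <= b%:R * 2%:R ^- (len O i).+1 :> rat.
  by rewrite -(ler_nat rat) -natr1 => h; rewrite -[X in _ + X]mul1r -mulrDl ler_pM2r.
by apply/andP; split; rewrite ltr_nat; apply/negP => /gap; lra.
Qed.

Lemma is_code_exists O i : act O i -> partial_sum O i.+1 <= 1 ->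
  exists2 p, size p = (len O i).+1 & is_code O i (str2nat p).
Proof.
move=> ai; rewrite partial_sumS ai (pow2S (len O i)).
set n := (len O i).+1; set D := total_len O i; set a := (scaled_sum O i * 2 ^ n)%N.
move=> le1.
(* [v] is the partial sum times [2 ^ n], rounded up. *)
pose v := ((a + 2 ^ D).-1 %/ 2 ^ D)%N.
have D0 : (0 < 2 ^ D)%N by rewrite expn_gt0.
have lo : (a <= v * 2 ^ D)%N.
  have := divn_eq (a + 2 ^ D).-1 (2 ^ D); have := ltn_pmod (a + 2 ^ D).-1 D0.
  by rewrite -/v; lia.
have hi : (v * 2 ^ D < a + 2 ^ D)%N by have := leq_trunc_div (a + 2 ^ D).-1 (2 ^ D); lia.
have v_lt : (v < 2 ^ n)%N.
  rewrite -(ltn_pmul2r D0); apply: (leq_trans hi).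
  rewrite -(ler_nat rat) natrD !natrM !natrX scaled_sumE mulrAC -/D.
  rewrite -[X in _ + X]mul1r -mulrDl ler_pM2r ?exprn_gt0 //.
  have n0 : 0 < 2%:R ^+ n :> rat by rewrite exprn_gt0.
  have e : 2%:R ^- n * 2%:R ^+ n = 1 :> rat by rewrite mulVf // gt_eqF.
  have := ler_pM2r n0 (partial_sum O i + 2%:R * 2%:R ^- n) 1; rewrite le1 mul1r mulrDl -mulrA e.
  by lra.
have [p sp vp] := bval_surj v_lt; exists p => //.
by rewrite /is_code ai /codesize /codeval str2natK sp eqxx vp lo hi.
Qed.

(** The machine searches for the request whose code is the input and returns its output, so it halts
    on codes only. *)
Lemma kraft_chaitin :
  computable 1 (fun O v => act O (nth 0%N v 0)) ->
  computable 1 (fun O v => len O (nth 0%N v 0)) ->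
  computable 1 (fun O v => out O (nth 0%N v 0)) ->
  exists2 M, prefix_free M &
    forall O, (forall i, partial_sum O i <= 1) -> forall i, act O i ->
      exists2 p, size p = (len O i).+1 & eval O M [:: str2nat p] (out O i).
Proof.
move=> hact hlen [Pout hout].
(* Negated because [PMu] searches for a zero. *)
have [Pchk hchk] := computable_negb (B := fun O v => is_code O (nth 0%N v 0) (nth 0%N v 1))
  (computable_is_code hact hlen).
have chk0 O i m : eval O Pchk [:: i; m] 0 <-> is_code O i m.
  have h := hchk O [:: i; m] erefl; rewrite /= in h.
  split=> [h0|c]; last by rewrite c in h.
  by have := eval_functional h0 h; case: is_code.
exists (PComp Pout [:: PMu Pchk]).
  move=> O p q [y evp] [z evq].
  have code r y' : eval O (PComp Pout [:: PMu Pchk]) [:: str2nat r] y' -> exists i, is_code O i (str2nat r).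
    move=> ev; inversion ev as [| | |f gs v w y'' ev1 ev2| | | |]; subst.
    have [i _ {ev ev1 ev2} ev] := evals1 ev1.
    by inversion ev as [| | | | | |f v n ev1 ev2|]; subst; exists i; apply/chk0.
  have [i ci] := code _ _ evp; have [j cj] := code _ _ evq.
  exact: is_code_antichain ci cj.
move=> O le1 i ai; have [p sp cp] := is_code_exists ai (le1 _).
exists p => //; apply: (@ev_comp _ _ _ _ [:: i]); last exact: (hout O [:: i]).
constructor; last by constructor.
apply: ev_mu; first exact/chk0.
(* An earlier request with the same code would have a cylinder that ends before it begins. *)
move=> j lt_ji; exists 0%N; have := hchk O [:: j; str2nat p] erefl.
case cj: is_code => //=; have := is_code_gap lt_ji cj cp.
by rewrite ltr_pM2r ?pow2_gt0 // ltr_nat ltnNge leqnSn.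
Qed.

End KraftChaitin.

(** * Pairing *)

Local Open Scope nat_scope.

(* Inverse of the bijection [(a, b) |-> 2 ^ a * (2 * b + 1) - 1]. *)
Definition pfst s := logn 2 s.+1.
Definition psnd s := (s.+1 %/ 2 ^ pfst s)./2.
Definition pairn a b := (2 ^ a * b.*2.+1).-1.

Lemma pairnS a b : (pairn a b).+1 = 2 ^ a * b.*2.+1.
Proof. by rewrite /pairn prednK // muln_gt0 expn_gt0. Qed.

Lemma pfst_pairn a b : pfst (pairn a b) = a.
Proof.
rewrite /pfst pairnS lognM ?expn_gt0 // pfactorK // lognE /=.
by rewrite dvdn2 /= odd_double addn0.
Qed.

Lemma psnd_pairn a b : psnd (pairn a b) = b.
Proof. by rewrite /psnd pfst_pairn pairnS mulKn ?expn_gt0 //= uphalf_double. Qed.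

Lemma unpairK s : pairn (pfst s) (psnd s) = s.
Proof.
apply: succn_inj; rewrite pairnS /psnd; set m := s.+1 %/ _.
have dv : 2 ^ pfst s %| s.+1 by apply: pfactor_dvdnn.
have m_odd : odd m.
  have := pfactor_dvdn (pfst s).+1 (isT : prime 2) (ltn0Sn s).
  rewrite -/(pfst s) ltnn => h; rewrite -[odd m]negbK -dvdn2.
  apply: contraFN h => /dvdnP[x ex]; apply/dvdnP; exists x.
  by rewrite -{1}(divnK dv) -/m ex expnS mulnA.
have -> : m./2.*2.+1 = m by rewrite -{2}(odd_double_half m) m_odd.
by rewrite /m mulnC divnK.
Qed.

Lemma pfst_leq s : pfst s <= s.
Proof. by rewrite -ltnS; apply: ltn_logl. Qed.

Lemma psnd_leq s : psnd s <= s.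
Proof. by have := leq_div s.+1 (2 ^ pfst s); rewrite /psnd; lia. Qed.

Lemma iter_halfE k n : iter k half n = n %/ 2 ^ k.
Proof. by elim: k => [|k /= ->]; rewrite ?divn1 // -divn2 -divnMA -expnSr. Qed.

Lemma computable_pfst k F : computable k F -> computable k (fun O v => pfst (F O v)).
Proof.
apply: computable1; apply: (computable_ext (F := fun _ v => \sum_(i < (nth 0 v 0).+1)
  (iter (val i).+1 half (nth 0 v 0).+1 * 2 ^ (val i).+1 == (nth 0 v 0).+1))).
  move=> O v _; move: (nth 0 v 0) => s.
  under eq_bigr => i _ do rewrite iter_halfE -dvdn_eq pfactor_dvdn //.
  by rewrite sum_ltn; apply/minn_idPr/ltnW; rewrite ltnS pfst_leq.
apply: (computable_sum (G := fun _ w =>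
  iter (nth 0 w 0).+1 half (nth 0 w 1).+1 * 2 ^ (nth 0 w 0).+1 == (nth 0 w 1).+1)); auto 9 with comp.
Qed.
#[local] Hint Resolve computable_pfst : comp.

Lemma computable_psnd k F : computable k F -> computable k (fun O v => psnd (F O v)).
Proof.
move=> hF; apply: (computable_ext (F := fun O v => (iter (pfst (F O v)) half (F O v).+1)./2)).
  by move=> O v _; rewrite iter_halfE.
auto 9 with comp.
Qed.
#[local] Hint Resolve computable_psnd : comp.

(* [s] codes a pair [(i, t)] such that [t] is the first time at which [C i] holds. *)
Definition fresh (C : nat -> nat -> bool) s : bool :=
  C (pfst s) (psnd s) && ~~ ((0 < psnd s) && C (pfst s) (psnd s).-1).

Lemma fresh_exists (C : nat -> nat -> bool) i t :
  C i t -> exists2 s, fresh C s & pfst s = i.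
Proof.
move=> Cit; have ex : exists t, C i t by exists t.
case: (ex_minnP ex) => t0 Ct0 mint; exists (pairn i t0); last exact: pfst_pairn.
rewrite /fresh pfst_pairn psnd_pairn Ct0; case: t0 {Ct0} mint => //= t0 mint.
by apply/negP => /mint; rewrite ltnn.
Qed.

Lemma computable_fresh (C : oracle -> nat -> nat -> bool) :
  (forall k I T, computable k I -> computable k T ->
     computable k (fun O v => C O (I O v) (T O v))) ->
  computable 1 (fun O v => fresh (C O) (nth 0 v 0)).
Proof. by move=> hC; rewrite /fresh; auto 9 with comp. Qed.

Local Open Scope ring_scope.

(** Both components of a pair are at most its code, so unpairing injects the indices below [n] into
    the square of side [n]. *)
Lemma sum_unpair_le (f : nat -> nat -> rat) n : (forall a b, 0 <= f a b) ->
  \sum_(s < n) f (pfst s) (psnd s) <= \sum_(a < n) \sum_(b < n) f a b.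
Proof.
move=> f0; rewrite pair_bigA /=.
pose h (s : 'I_n) : 'I_n * 'I_n :=
  (Ordinal (leq_ltn_trans (pfst_leq s) (ltn_ord s)),
   Ordinal (leq_ltn_trans (psnd_leq s) (ltn_ord s))).
have h_inj : {in [set: 'I_n] &, injective h}.
  by move=> s t _ _ [e1 e2]; apply: val_inj; rewrite /= -(unpairK s) -(unpairK t) e1 e2.
have <- : \sum_(x in h @: [set: 'I_n]) f x.1 x.2 = \sum_(s < n) f (pfst s) (psnd s).
  by rewrite big_imset //=; apply: eq_bigl => s; rewrite inE.
rewrite [leRHS](bigID [in h @: [set: 'I_n]]) /= lerDl.
by apply: sumr_ge0.
Qed.

(** A monotone condition has a single first time, so each [i] is requested once and its weight is
    not counted again at later times. *)
Lemma sum_fresh_le (C : nat -> nat -> bool) (w : nat -> rat) n :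
  (forall i t t', (t <= t')%N -> C i t -> C i t') -> (forall i, 0 <= w i) ->
  \sum_(s < n | fresh C s) w (pfst s) <= \sum_(i < n | C i n) w i.
Proof.
move=> monoC w0.
pose f i t := if C i t && ~~ ((0 < t)%N && C i t.-1) then w i else 0.
rewrite big_mkcond [leRHS]big_mkcond.
apply: le_trans (sum_unpair_le (f := f) n _) _ => [i t|].
  by rewrite /f; case: ifP.
apply: ler_sum => i _.
have -> : \sum_(t < n) f i t = if (0 < n)%N && C i n.-1 then w i else 0.
  move: (val i) => {}i; elim: n => [|n IHn]; first by rewrite big_ord0.
  rewrite big_ord_recr IHn /f /=; case: n {IHn} => [|n] /=; first by rewrite andbT add0r.
  have := monoC i _ _ (leqnSn n); case: (C i n) => [->//|_]; first by rewrite addr0.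
  by rewrite andbT add0r.
case: n i => [[]//|n i] /=; have := monoC i _ _ (leqnSn n).
by case: (C i n) => [->//|_]; case: ifP.
Qed.

Lemma sum_unique_le n (P : pred nat) (w : nat -> rat) B : 0 <= B ->
  (forall i j, P i -> P j -> i = j) -> (forall i, P i -> w i <= B) ->
  \sum_(i < n | P i) w i <= B.
Proof.
move=> B0 uniqP wB; case: (pickP (fun i : 'I_n => P i)) => [i Pi|noP]; last by rewrite big_pred0.
rewrite (big_pred1 i) ?wB // => j /=; apply/idP/eqP => [Pj|->//].
exact/val_inj/uniqP.
Qed.

(** * Complexity and the coding theorem *)

Local Open Scope nat_scope.

(** [PMu PSucc] diverges, so the recursion halts only on code 0, the empty string. Through
    universality every [x] gets a program, which makes [K] a true minimum instead of an arbitrary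
    value of [epsilon]. *)
Lemma prefix_free_on_empty x : exists2 M, prefix_free M & forall O, runs O M [::] x.
Proof.
have [P hP] := computable_const 0 (str2nat x).
exists (PPrec P (PMu PSucc)) => [O p q|O]; last by apply: ev_prec0; apply: hP.
suff nilP r : halts O (PPrec P (PMu PSucc)) r -> r = [::] by move=> /nilP-> /nilP->.
case: r => // b r [y ev].
have e : str2nat (b :: r) = ((str2nat r).*2 + b).+1 by rewrite /= addn1.
rewrite e in ev; inversion ev as [| | | | |f g n' v z y' ev1 ev2| |]; subst.
inversion ev2 as [| | | | | |f v n' ev3 _|]; subst; inversion ev3.
Qed.

Lemma is_K_K U O x : universal_pf U -> is_K U O x (K U O x).
Proof.
move=> [pfU univU]; rewrite /K; apply: epsilon_spec.
have [M pfM MO] := prefix_free_on_empty x; have [q0 q0P] := univU M pfM.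
have [p0 rp0] : exists p, runs O U p x by exists (q0 ++ [::]); apply/q0P.
pose P k := if excluded_middle_informative (exists2 p, size p = k & runs O U p x) then true else false.
have PP k : P k <-> exists2 p, size p = k & runs O U p x.
  by rewrite /P; case: excluded_middle_informative.
have exP : exists k, P k by exists (size p0); apply/PP; exists p0.
case: (ex_minnP exP) => k /PP[p sp rp] mink; exists k; split; first by exists p.
by move=> q rq; apply: mink; apply/PP; exists q.
Qed.

Lemma K_witness U O x : universal_pf U -> exists2 p, size p = K U O x & runs O U p x.
Proof. by move=> hU; have [[p [sp rp]] _] := is_K_K O x hU; exists p. Qed.

Lemma K_le U O p x : universal_pf U -> runs O U p x -> K U O x <= size p.
Proof. by move=> hU rp; have [_] := is_K_K O x hU; apply. Qed.

Lemma K_invariance U M : universal_pf U -> prefix_free M ->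
  exists c, forall O p x, runs O M p x -> K U O x <= size p + c.
Proof.
move=> hU pfM; have [q0 q0P] := hU.2 M pfM; exists (size q0) => O p x /q0P r.
by rewrite addnC -size_cat; apply: K_le.
Qed.

Local Open Scope ring_scope.

Lemma prefix_free_antichain M O (D : pred nat) : prefix_free M ->
  (forall n, D n -> exists y, eval O M [:: n] y) -> antichain (fun p => D (str2nat p)).
Proof. by move=> pfM hD p q /hD hp /hD hq; apply: pfM hp hq. Qed.

Section CodingTheorem.

Variable N : prog.
Hypothesis pfN : prefix_free N.
Variable F : oracle -> nat -> nat -> nat.
Hypothesis computable_F : forall k T X, computable k T -> computable k X ->
  computable k (fun O v => F O (T O v) (X O v)).
Hypothesis F_mono : forall O t t' n y, (t <= t')%N -> F O t n = y.+1 -> F O t' n = y.+1.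
Hypothesis F_clock : forall O n y, eval O N [:: n] y <-> exists t, F O t n = y.+1.

(** A code [p < t] has length at most [p], so [2 ^ t] is a common denominator. *)
Definition scaled_mass O t y :=
  (\sum_(p < t) (F O t p == y.+1) * 2 ^ (t - codesize p))%N.

(** The approximation from below, at time [t], of the algorithmic probability of [y] under [N]. *)
Definition mass O t y : rat := \sum_(p < t | F O t p == y.+1) 2%:R ^- codesize p.

(* [i] codes a pair [(y, k)]. *)
Definition heavy O i t : bool := (2 ^ t.+1 <= scaled_mass O t (pfst i) * 2 ^ psnd i)%N.

Lemma heavyE O i t : heavy O i t = (2%:R * 2%:R ^- psnd i <= mass O t (pfst i)).
Proof.
have e y : (scaled_mass O t y)%:R = mass O t y * 2%:R ^+ t.
  rewrite /scaled_mass /mass natr_sum big_distrl [RHS]big_mkcond /=.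
  apply: eq_bigr => p _; case: (F O t p == _); rewrite ?mul0n // mul1n natrX mulrC.
  by rewrite -pow2_sub // (leq_trans (codesize_leq p)) // ltnW.
have k0 : 0 < 2%:R ^+ psnd i :> rat by rewrite exprn_gt0.
rewrite /heavy -(ler_nat rat) natrM !natrX e exprS mulrAC ler_pM2r ?exprn_gt0 //.
by rewrite ler_pdivrMr.
Qed.

Lemma mass_mono O y t t' : (t <= t')%N -> mass O t y <= mass O t' y.
Proof.
move=> le_tt; rewrite /mass (big_ord_widen_cond _ (fun p => F O t p == y.+1)
  (fun p => 2%:R ^- codesize p) le_tt).
rewrite big_mkcond [leRHS]big_mkcond; apply: ler_sum => p _.
case: ifP => [/andP[/eqP e _]|_]; first by rewrite (F_mono le_tt e) eqxx.
by case: ifP => // _; apply: pow2_ge0.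
Qed.

Lemma mass_ge0 O t y : 0 <= mass O t y.
Proof. by apply: sumr_ge0 => p _; apply: pow2_ge0. Qed.

Lemma sum_mass_le1 O t n : \sum_(y < n) mass O t y <= 1.
Proof.
rewrite /mass.
under eq_bigr => y _ do rewrite big_mkcond.
rewrite exchange_big /=; apply: le_trans (kraft (D := fun p => 0 < F O t p)%N t _).
  rewrite [leRHS]big_mkcond; apply: ler_sum => p _; rewrite -big_mkcond.
  case Fp: (F O t p) => [|z] /=; first by rewrite big_pred0 // => y; rewrite Fp.
  apply: (@sum_unique_le n (fun y => z.+1 == y.+1) (fun=> 2%:R ^- codesize p)) => //.
  - exact: pow2_ge0.
  - by move=> i j /eqP[<-] /eqP[].
apply: (@prefix_free_antichain N O (fun p => 0 < F O t p)%N pfN) => p; case Fp: (F O t p) => [//|z] _.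
by exists z; apply/F_clock; exists t.
Qed.

(** The admissible [k] form a final segment, whose geometric sum is at most twice its first term.
    The factor 2 in [heavy] absorbs this, so all requests for one string together weigh no more than
    its mass. *)
Lemma sum_pow2_tail n (m : rat) : 0 <= m ->
  \sum_(k < n | 2%:R * 2%:R ^- k <= m) 2%:R ^- k <= m.
Proof.
move=> m0; pose S n : rat := \sum_(k < n | 2%:R * 2%:R ^- k <= m) 2%:R ^- k.
(* Strengthened for the induction: once the sum has started, the whole remaining tail [2 * 2 ^- n]
   still fits below [m]. *)
suff: S n = 0 \/ S n + 2%:R * 2%:R ^- n <= m.
  by case=> [Sn|]; [rewrite -/(S n) Sn | have := pow2_ge0 n; rewrite -/(S n); lra].
have SS i : S i.+1 = S i + (if 2%:R * 2%:R ^- i <= m then 2%:R ^- i else 0).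
  by rewrite /S big_mkcond big_ord_recr /= -big_mkcond.
elim: n => [|n IHn]; first by left; rewrite /S big_ord0.
rewrite SS -pow2S; have := pow2_gt0 n; case: ifP => P0 p0.
  by right; case: IHn => [->|]; lra.
by case: IHn => [->|h]; [left; rewrite addr0 | right; lra].
Qed.

Lemma mass_bracket O t y : 0 < mass O t y -> exists k,
  2%:R * 2%:R ^- k <= mass O t y < 4%:R * 2%:R ^- k.
Proof.
move=> m0.
have m1 : mass O t y <= 1.
  apply: le_trans (sum_mass_le1 O t y.+1); rewrite big_ord_recr /= lerDr.
  by apply: sumr_ge0 => z _; apply: mass_ge0.
have exk : exists k, 2%:R * 2%:R ^- k <= mass O t y.
  have [p Fp|noF] := pickP (fun p : 'I_t => F O t p == y.+1); last first.
    by move: m0; rewrite /mass big_pred0 ?ltxx.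
  exists (codesize p).+1; rewrite -pow2S /mass (bigD1 p) //= lerDl.
  by apply: sumr_ge0 => q _; apply: pow2_ge0.
case: (ex_minnP exk) => k Pk mink; exists k; rewrite Pk ltNge; apply/negP => h.
case: k Pk mink h => [|k] Pk mink h; first by move: m1 h; rewrite expr0 invr1; lra.
have : 2%:R * 2%:R ^- k <= mass O t y by rewrite pow2S mulrA -natrM.
by move=> /mink; rewrite ltnn.
Qed.

(** A request for [y] of length [k] is issued as soon as the mass of [y] reaches [2 * 2 ^- k]; by
    [mass_bracket] some issued [k] matches the mass up to a constant factor. *)
Lemma coding_theorem_clock U : universal_pf U ->
  exists c, forall O t y, mass O t (str2nat y) <= 2%:R ^+ c * 2%:R ^- K U O y.
Proof.
move=> hU.
have heavy_mono O i t t' : (t <= t')%N -> heavy O i t -> heavy O i t'.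
  by move=> le_tt; rewrite !heavyE => h; apply: le_trans h (mass_mono _ _ le_tt).
have computable_heavy k I T : computable k I -> computable k T ->
    computable k (fun O v => heavy O (I O v) (T O v)).
  move=> hI hT; apply: (computable_comp (G := fun O v => heavy O (nth 0%N v 0) (nth 0%N v 1))
    (Fs := [:: I; T])) => //.
  apply: computable_leq; first by auto with comp.
  apply: computable_mul; last by auto with comp.
  apply: (computable_sum (G := fun O w => (F O (nth 0 w 2) (nth 0 w 0) == (pfst (nth 0 w 1)).+1)
    * 2 ^ (nth 0 w 2 - codesize (nth 0 w 0)))%N); auto 9 with comp.
have [||M pfM hM] := @kraft_chaitin (fun O => fresh (heavy O)) (fun _ s => psnd (pfst s))
  (fun _ s => pfst (pfst s)) (computable_fresh computable_heavy); try by auto with comp.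
(* Of the extra 3, two come from the factor 4 in [mass_bracket] and one from the code length
   [k.+1]. *)
have [c hc] := K_invariance hU pfM; exists c.+3 => O t y.
have [m0|] := ltP 0 (mass O t (str2nat y)); last first.
  by move=> m0; apply: le_trans m0 _; rewrite mulr_ge0 ?exprn_ge0 ?pow2_ge0.
have [k /andP[lo hi]] := mass_bracket m0.
have [|s fs es] := @fresh_exists (heavy O) (pairn (str2nat y) k) t.
  by rewrite heavyE pfst_pairn psnd_pairn.
have [|p sp evp] := hM O _ s fs.
  move=> n; apply: le_trans (sum_fresh_le n (w := fun i => 2%:R ^- psnd i) (@heavy_mono O) _) _.
    by move=> i; apply: pow2_ge0.
  rewrite big_mkcond /=.
  pose f y k := if 2%:R * 2%:R ^- k <= mass O n y then 2%:R ^- k else 0 : rat.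
  apply: le_trans (_ : \sum_(i < n) f (pfst i) (psnd i) <= 1).
    by apply: ler_sum => i _; rewrite heavyE.
  apply: le_trans (sum_unpair_le _ _) _ => [a b|].
    by rewrite /f; case: ifP => // _; apply: pow2_ge0.
  apply: le_trans (sum_mass_le1 O n n); apply: ler_sum => a _.
  by rewrite /f -big_mkcond; apply: sum_pow2_tail; apply: mass_ge0.
have := hc O p y; rewrite /runs es pfst_pairn in evp *.
move=> /(_ evp); rewrite sp es psnd_pairn => Kle.
apply: le_trans (ltW hi) _.
rewrite ler_pdivlMr ?exprn_gt0 // -mulrA [_^-1 * _]mulrC.
rewrite mulrA ler_pdivrMr ?exprn_gt0 // -exprD (_ : 4%:R = 2%:R ^+ 2) // -exprD.
by rewrite ler_weXn2l ?ler1n //; lia.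
Qed.

End CodingTheorem.

(** The finitely many programs of [A] below [n] have all halted by some common time, and the mass at
    that time dominates their weights. *)
Lemma coding_theorem U N : universal_pf U -> prefix_free N ->
  exists c, forall O y n (A : pred nat), (forall m, A m -> eval O N [:: m] (str2nat y)) ->
    \sum_(m < n | A m) 2%:R ^- codesize m <= 2%:R ^+ c * 2%:R ^- K U O y :> rat.
Proof.
move=> hU pfN; have [F [cF mF eF]] := clock1 true N.
have [c hc] := coding_theorem_clock pfN cF mF eF hU; exists c => O y n A hA.
have [t le_nt ht] : exists2 t, (n <= t)%N & forall m, (m < n)%N -> A m -> F O t m = (str2nat y).+1.
  elim: n => [|n [t le_nt ht]]; first by exists 0%N.
  have [An|nAn] := boolP (A n).
    have [t' ht'] := (eF _ _ _).1 (hA _ An).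
    exists (maxn t.+1 t'); first by rewrite leq_max ltnS le_nt.
    move=> m; rewrite ltnS leq_eqVlt => /predU1P[-> _|mn Am].
      by apply: mF ht'; apply: leq_maxr.
    by apply: mF (ht _ mn Am); rewrite leq_max leqnSn.
  exists t.+1 => // m; rewrite ltnS leq_eqVlt => /predU1P[->|mn Am]; first by rewrite (negbTE nAn).
  by apply: mF (ht _ mn Am).
apply: le_trans (hc O t y); rewrite /mass.
rewrite (big_ord_widen_cond _ A (fun p => 2%:R ^- codesize p) le_nt).
rewrite big_mkcond [leRHS]big_mkcond; apply: ler_sum => p _.
case: ifP => [/andP[Ap pn]|_]; first by rewrite ht ?eqxx.
by case: ifP => // _; apply: pow2_ge0.
Qed.

(** * Conservation of information about the halting sequence *)

Lemma prefix_free_comp e U : prefix_free U -> prefix_free (PComp e [:: U]).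
Proof.
move=> pfU O p q [y hp] [z hq]; apply: (pfU O p q).
  inversion hp as [| | |f gs v w y' ev1 ev2| | | |]; subst.
  by have [i _ evi] := evals1 ev1; exists i.
inversion hq as [| | |f gs v w y' ev1 ev2| | | |]; subst.
by have [i _ evi] := evals1 ev1; exists i.
Qed.

Lemma eval_comp1 O f g v x y : eval O g v x -> eval O f [:: x] y -> eval O (PComp f [:: g]) v y.
Proof. by move=> evg; apply: ev_comp; constructor => //; constructor. Qed.

(** If the subtraction is cut off at zero, the left side is 1 and the right side is at least 1. It
    serves to bound the weights given by [len]. *)
Lemma pow2_trunc (m n : nat) : 2%:R ^- (m - n) <= 2%:R ^- m * 2%:R ^+ n :> rat.
Proof.
rewrite ler_pdivlMl ?exprn_gt0 // ler_pdivrMr ?exprn_gt0 // -exprD.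
by rewrite ler_weXn2l ?ler1n //; lia.
Qed.

Lemma halting_seqP U n :
  code_ans (halting_seq U n) == 2%N <-> exists y, eval emptyOracle U [:: n] y.
Proof. by rewrite /halting_seq; case: excluded_middle_informative. Qed.

(* A Kraft-Chaitin request for [x] is a tuple of a program [a] of [y] under the oracle,
   a program [p] of [x] and the least program [r] of [y]; the oracle certifies the
   minimality of [r]. By the coding theorem the weights [2 ^- |p|] add up to at most [2
   ^ (c0 - |r|)], hence the length [|a| + |p| + c0 - |r|]. *)
Lemma relative_complexity_preimage U e : universal_pf U ->
  exists c, forall x y, runs emptyOracle e x y ->
    (K U (halting_seq U) x + K U emptyOracle y <= K U emptyOracle x + K U (halting_seq U) y + c)%N.
Proof.
move=> hU; pose N := PComp e [:: U].
have pfN : prefix_free N := prefix_free_comp hU.1.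
have [c0 hc0] := coding_theorem hU pfN.
have [F1 [cF1 mF1 eF1]] := clock1 true U.
have [F0 [cF0 mF0 eF0]] := clock1 false U.
have [G [cG mG eG]] := clock1 false N.
(* The oracle claims that [j] halts (answer code 2), but by time [t] it has not been seen to give an
   output other than that of [a]. When no [j < r] is unsettled, [r] is certified as the least
   program. *)
pose unsettled (O : oracle) t a j : bool :=
  (code_ans (O j) == 2%N) && ~~ ((0 < F0 O t j)%N && ~~ (F0 O t j == F1 O t a)).
pose C O i t : bool :=
  let a := pfst i in let p := pfst (psnd i) in let r := psnd (psnd i) in
  (((0 < F1 O t a)%N && (G O t p == F1 O t a)) && (0 < F0 O t p)%N) &&
  ((F0 O t r == F1 O t a) && ((\sum_(j < r) unsettled O t a j)%N == 0%N)).
have CP O a p r t : reflect (exists y x,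
    [/\ F1 O t a = y.+1, G O t p = y.+1, F0 O t p = x.+1, F0 O t r = y.+1 &
     forall j, (j < r)%N -> code_ans (O j) == 2%N -> exists2 z, z != y & F0 O t j = z.+1])
    (C O (pairn a (pairn p r)) t).
  rewrite /C !psnd_pairn !pfst_pairn; apply: (iffP idP).
    case e1: (F1 O t a) => [//|y]; case e0: (F0 O t p) => [|x]; first by rewrite andbF.
    rewrite /= andbT => /andP[/eqP eGp /andP[/eqP eFr]].
    rewrite sum_nat_eq0 => /forallP h; exists y, x; split=> // j lt_jr Oj.
    have := h (Ordinal lt_jr); rewrite /unsettled /= Oj e1 /=.
    by case: (F0 O t j) => [//|z]; rewrite /= eqb0 negbK eqSS => ?; exists z.
  move=> [y [x [e1 eGp e0 eFr h]]]; rewrite e1 eGp e0 eFr eqxx /= sum_nat_eq0.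
  apply/forallP => j; rewrite /= eqb0 /unsettled e1; apply/negP => /andP[Oj].
  by have [z zy ->] := h j (ltn_ord j) Oj; rewrite /= eqSS zy.
have C_mono O i t t' : (t <= t')%N -> C O i t -> C O i t'.
  move=> le_tt; rewrite -(unpairK i) -(unpairK (psnd i)).
  move=> /CP[y [x [e1 eGp e0 eFr h]]]; apply/CP; exists y, x; split.
  - exact: mF1 e1.
  - exact: mG eGp.
  - exact: mF0 e0.
  - exact: mF0 eFr.
  - by move=> j lt_jr Oj; have [z zy ez] := h j lt_jr Oj; exists z => //; apply: mF0 ez.
have computable_C k I T : computable k I -> computable k T ->
    computable k (fun O v => C O (I O v) (T O v)).
  move=> hI hT; apply: (computable_comp (G := fun O v => C O (nth 0%N v 0) (nth 0%N v 1))
    (Fs := [:: I; T])) => //.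
  have cU : computable 2 (fun O v =>
      (\sum_(j < psnd (psnd (nth 0 v 0))) unsettled O (nth 0 v 1) (pfst (nth 0 v 0)) j)%N).
    apply: (computable_sum (G := fun O w => unsettled O (nth 0%N w 2) (pfst (nth 0%N w 1)) (nth 0%N w 0)));
      rewrite /unsettled; auto 12 with comp.
  rewrite /C; auto 12 with comp.
pose len i := (codesize (pfst i) + codesize (pfst (psnd i)) + c0 - codesize (psnd (psnd i)))%N.
(* The output is read off at the time [psnd s] of the request, when [C] guarantees that [p] has
   halted. *)
have [|||M pfM hM] := @kraft_chaitin (fun O => fresh (C O)) (fun _ s => len (pfst s))
    (fun O s => (F0 O (psnd s) (pfst (psnd (pfst s)))).-1).
- exact: (computable_fresh computable_C).
- by rewrite /len; auto 12 with comp.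
- by auto 12 with comp.
have [cM hcM] := K_invariance hU pfM.
set H := halting_seq U.
(* Under the true halting sequence the certificate is correct. A least code also has least length,
   since [codesize] is monotone. *)
have minimal a p r t : C H (pairn a (pairn p r)) t -> exists y,
    [/\ F1 H t a = (str2nat y).+1, eval emptyOracle U [:: r] (str2nat y),
     codesize r = K U emptyOracle y &
     forall r', eval emptyOracle U [:: r'] (str2nat y) -> (r <= r')%N].
  move=> /CP[n [x [e1 eGp e0 eFr h]]]; exists (nat2str n); rewrite nat2strK.
  have evr : eval emptyOracle U [:: r] n by apply/(eF0 H); exists t.
  have rmin r' : eval emptyOracle U [:: r'] n -> (r <= r')%N.
    move=> evr'; rewrite leqNgt; apply/negP => lt_r'r.
    have [|z zn ez] := h r' lt_r'r; first by apply/halting_seqP; exists n.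
    have evz : eval emptyOracle U [:: r'] z by apply/(eF0 H); exists t.
    by rewrite (eval_functional evz evr') eqxx in zn.
  split=> //; apply/eqP; rewrite eqn_leq; apply/andP; split; last first.
    by apply: K_le; rewrite // /runs !nat2strK.
  have [q <- rq] := K_witness emptyOracle (nat2str n) hU.
  by rewrite -[q]str2natK; apply/leq_codesize2/rmin; rewrite -[n]nat2strK.
(* A fixed [a] determines [y], and [y] determines [r]. The sum over [p] is then at most
   [2 ^- codesize a], because the factors $2^{c_0}$ and $2^{-\mathbf{K}(y)}$ of the coding theorem
   cancel those in [len]; Kraft's inequality for [U] under [H] sums over [a]. *)
have sum_le1 n : partial_sum (fun O => fresh (C O)) (fun _ s => len (pfst s)) H n <= 1.
  apply: le_trans (sum_fresh_le n (w := fun i => 2%:R ^- len i) (@C_mono H) _) _.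
    by move=> i; apply: pow2_ge0.
  pose f a i := if C H (pairn a i) n then 2%:R ^- len (pairn a i) else 0 : rat.
  have f0 a i : 0 <= f a i by rewrite /f; case: ifP => // _; apply: pow2_ge0.
  have -> : \sum_(i < n | C H i n) 2%:R ^- len i = \sum_(i < n) f (pfst i) (psnd i).
    by rewrite big_mkcond; apply: eq_bigr => i _; rewrite /f unpairK.
  apply: le_trans (sum_unpair_le n f0) _.
  apply: le_trans (kraft (D := fun a => 0 < F1 H n a)%N n _); last first.
    apply: (@prefix_free_antichain U H (fun a => 0 < F1 H n a)%N hU.1) => a.
    by case e1: (F1 H n a) => [//|y] _; exists y; apply/eF1; exists n.
  rewrite [leRHS]big_mkcond; apply: ler_sum => a _.
  apply: le_trans (_ : \sum_(i < n) f a (pairn (pfst i) (psnd i)) <= _).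
    by apply: ler_sum => i _; rewrite unpairK.
  apply: le_trans (sum_unpair_le n (f := fun p r => f a (pairn p r)) _) _ => //.
  case e1: (F1 H n a) => [|m].
    rewrite big1 // => p _; rewrite big1 // => r _; rewrite /f.
    by case: ifP => // /CP[y [x []]]; rewrite e1.
  move: e1; rewrite -(nat2strK m) /=; move: (nat2str m) => y e1.
  pose A p := G H n p == (str2nat y).+1.
  pose B p := 2%:R ^- codesize a * (2%:R ^- codesize p * 2%:R ^- c0 * 2%:R ^+ K U emptyOracle y) : rat.
  apply: le_trans (_ : \sum_(p < n | A p) B p <= _).
    rewrite [leRHS]big_mkcond; apply: ler_sum => p _.
    have B0 : 0 <= B p by rewrite /B !mulr_ge0 ?pow2_ge0 ?exprn_ge0.
    rewrite /f -big_mkcond /=; case Ap: (A p); last first.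
      rewrite big_pred0 // => r; apply/negP => /CP[z [x [e1' eGp _ _ _]]].
      by move/negP: Ap; apply; rewrite /A eGp -e1' e1.
    apply: (@sum_unique_le n (fun r => C H (pairn a (pairn p r)) n)
      (fun r => 2%:R ^- len (pairn a (pairn p r)))) => // [r r'|r].
      move=> /minimal[z [e1z evz _ zmin]] /minimal[z' [e1z' evz' _ zmin']].
      have zz' : z = z' by apply: str2nat_inj; apply: succn_inj; rewrite -e1z -e1z'.
      rewrite -zz' in zmin' evz'.
      by apply/eqP; rewrite eqn_leq zmin // zmin'.
    move=> /minimal[z [e1z _ Kz _]].
    have zy : z = y by apply: str2nat_inj; apply: succn_inj; rewrite -e1z -e1.
    rewrite /len !psnd_pairn !pfst_pairn Kz zy; apply: le_trans (pow2_trunc _ _) _.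
    by rewrite /B !exprD !invfM !mulrA.
  rewrite -mulr_sumr -!mulr_suml -[leRHS]mulr1 ler_pM2l ?pow2_gt0 //.
  have := hc0 emptyOracle y n A; move=> /(_ _)/(le_trans _) h.
  rewrite -mulrA mulrC -ler_pdivlMl ?mulr_gt0 ?pow2_gt0 ?exprn_gt0 //.
  rewrite mulr1 invfM invrK; apply: hc0 => p /eqP Ap.
  by apply/(eG H); exists n.
exists (c0 + cM + c0).+1 => x y exy.
have [p sp rp] := K_witness emptyOracle x hU.
have [a sa ra] := K_witness H y hU.
have evN : eval emptyOracle N [:: str2nat p] (str2nat y) by apply: eval_comp1 rp exy.
pose P r := if excluded_middle_informative (eval emptyOracle U [:: r] (str2nat y)) then true else false.
have PP r : P r <-> eval emptyOracle U [:: r] (str2nat y).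
  by rewrite /P; case: excluded_middle_informative.
have exP : exists r, P r by have [q _ rq] := K_witness emptyOracle y hU; exists (str2nat q); apply/PP.
case: (ex_minnP exP) => r /PP rr rmin.
have [t1 e1] := (eF1 H _ _).1 ra; have [t2 e2] := (eG H _ _).1 evN.
have [t3 e3] := (eF0 H _ _).1 rp; have [t4 e4] := (eF0 H _ _).1 rr.
(* Each halting program below the least program [r] eventually shows an output other than [y], and
   finitely many of them do so by a common time. *)
have [t5 e5] : exists t, forall j, (j < r)%N -> code_ans (H j) == 2%N ->
    exists2 z, z != str2nat y & F0 H t j = z.+1.
  have : forall j, (j < r)%N -> ~~ P j.
    by move=> j; rewrite ltnNge; apply: contra => /rmin.
  elim: r {rr rmin e4} => [|r IHr] nP; first by exists 0%N.
  have [j /ltnW jr|t5 e5] := IHr; first exact: nP.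
  have [/halting_seqP[z evz]|nH] := boolP (code_ans (H r) == 2%N); last first.
    exists t5 => j; rewrite ltnS leq_eqVlt => /predU1P[->|]; first by rewrite (negbTE nH).
    exact: e5.
  have [t6 e6] := (eF0 H _ _).1 evz; exists (maxn t5 t6) => j.
  rewrite ltnS leq_eqVlt => /predU1P[-> _|jr Hj].
    exists z; last by apply: mF0 e6; apply: leq_maxr.
    by apply/eqP => ez; have /negP := nP r (ltnSn r); apply; apply/PP; rewrite -ez.
  by have [z' zy ez'] := e5 j jr Hj; exists z' => //; apply: mF0 ez'; apply: leq_maxl.
pose T := (t1 + t2 + t3 + t4 + t5)%N.
have CT : C H (pairn (str2nat a) (pairn (str2nat p) r)) T.
  apply/CP; exists (str2nat y), (str2nat x); split.
  - by apply: mF1 e1; rewrite /T; lia.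
  - by apply: mG e2; rewrite /T; lia.
  - by apply: mF0 e3; rewrite /T; lia.
  - by apply: mF0 e4; rewrite /T; lia.
  - move=> j jr Hj; have [z zy ez] := e5 j jr Hj; exists z => //.
    by apply: mF0 ez; rewrite /T; lia.
have [y' [ey' _ Kr _]] := minimal _ _ _ _ CT.
have {ey'} ey : y' = y.
  apply: str2nat_inj; apply: succn_inj; rewrite -ey'.
  by apply: mF1 e1; rewrite /T; lia.
rewrite {}ey in Kr.
have [s fs es] := fresh_exists CT.
have [q sq] := hM H sum_le1 s fs.
(* The request is issued at its own first time, which may differ from [T]; determinism identifies
   the output found there with [x]. *)
have := fs; rewrite /fresh => /andP[+ _].
rewrite es => /CP[_ [x' [_ _ e0' _ _]]].
have ex : x' = str2nat x by apply: (eval_functional _ rp); apply/(eF0 H); exists (psnd s).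
rewrite psnd_pairn pfst_pairn e0' ex /= => /(hcM H q x) Kx.
(* The coding theorem for the single program [p] shows that the subtraction in [len] is not
   truncated. *)
have le_r : (codesize r <= size p + c0)%N.
  have := hc0 emptyOracle y (str2nat p).+1 (pred1 (str2nat p)).
  rewrite (big_pred1 ord_max) => [|j]; last by apply/eqP/eqP => [ej|->//]; apply: val_inj.
  rewrite /codesize str2natK -/(codesize r) -Kr => h.
  have {}h : 2%:R ^- size p <= 2%:R ^+ c0 * 2%:R ^- codesize r :> rat by apply: h => m /eqP->.
  move: h; rewrite ler_pdivlMr ?exprn_gt0 // mulrC ler_pdivrMr ?exprn_gt0 //.
  by rewrite -exprD ler_eXn2l ?ltr1n // addnC.
move: Kx; rewrite sq es /len !psnd_pairn !pfst_pairn /codesize !str2natK -/(codesize r) sa sp.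
by move: le_r; rewrite sp -Kr; lia.
Qed.

Theorem theorem4 (U : prog) (hU : universal_pf U)
  (f : seq bool -> seq bool) (hf : partial_recursive f) :
  exists c : int, forall x : seq bool, I_H U (f x) < I_H U x + c.
Proof.
have [e he] := hf.
have [c1 hc1] := relative_complexity_preimage e hU.
(* [PZero] maps every input to code 0, the empty string; this bounds $\mathbf{I}(x;\mathcal{H})$
   from below by $\mathbf{I}(\perp;\mathcal{H}) - c_2$ and settles the inputs on which [e]
   diverges. *)
have [c2 hc2] := relative_complexity_preimage PZero hU.
pose k0 := K U emptyOracle [::].
exists (c1 + c2 + k0 + K U (halting_seq U) [::]).+1%:Z => x.
rewrite /I_H /Kplain /Kcond -/emptyOracle.
have [hx nx] := he x; have [[n evn]|/nx->] := classic (halts emptyOracle e x).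
  have exf : runs emptyOracle e x (f x).
    by rewrite (hx (nat2str n)) /runs nat2strK.
  by have := hc1 _ _ exf; lia.
have := hc2 x [::] (ev_zero _ _); rewrite /k0; lia.
Qed.
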